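(* Let $H$ be an infinite dimensional complex Hilbert space and let $T \in \overline{\mathcal{AN}(H)}$ be $\ast$-paranormal. Then there exist Hilbert spaces $H_0$, $H_1$, $H_2$ such that $H = H_0 \oplus H_1 \oplus H_2$ and, with respect to this decomposition, $$T = \begin{pmatrix} V_0 & 0 & 0 \\ 0 & \lambda V & A \\ 0 & 0 & B \end{pmatrix},$$ where (1) $\sigma_{ess}(|T|) = \{\lambda\}$ with $\lambda \geq 0$; (2) $H_0 = \bigoplus_{i=1}^{n} N(|T| - \alpha_i I)$, where $(\lambda, \|T\|] \cap \sigma(|T|) = \{\alpha_i\}_{i=1}^{n}$ (the $\alpha_i$ distinct) for some $n \in \mathbb{N} \cup \{\infty\}$ (or this set is empty, in which case $H_0 = \{0\}$), $H_1 = N(|T| - \lambda I)$ and $H_2 = (H_0 \oplus H_1)^\perp$; (3) $V_0 = \bigoplus_{i=1}^{n} \alpha_i U_i$, where $U_i \in \mathcal{B}(N(|T| - \alpha_i I))$ is unitary for each $i$; (4) $V \in \mathcal{B}(H_1)$ is an isometry if $H_1 \neq \{0\}$, and $A \in \mathcal{B}(H_2, H_1)$, $B \in \mathcal{B}(H_2)$ are such that $V^*A = 0$, $A^*A + B^*B \leq \lambda^2 I_{H_2}$ and $(\lambda^4 + k^2) I_{H_2} - 2k BB^* \geq 0$ for all $k > 0$.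
   Context: $\mathcal{B}(H_1,H_2)$ denotes the bounded linear operators from $H_1$ to $H_2$, $\mathcal{B}(H)=\mathcal{B}(H,H)$, $N(\cdot)$ denotes the null space, and $|T| = (T^*T)^{1/2}$. An operator $T \in \mathcal{B}(H)$ is absolutely norm attaining, written $T \in \mathcal{AN}(H)$, if for every nonzero closed subspace $L$ of $H$ there is a unit vector $x \in L$ with $\|Tx\| = \|T|_L\|$. $\overline{\mathcal{AN}(H)}$ is the closure of $\mathcal{AN}(H)$ in the operator norm. $T$ is $\ast$-paranormal if $\|T^*x\|^2 \leq \|T^2x\|\,\|x\|$ for all $x \in H$. The essential spectrum $\sigma_{ess}(S)$ of $S\in\mathcal{B}(H)$ is the spectrum of the image of $S$ in the Calkin algebra $\mathcal{B}(H)/\mathcal{K}(H)$, where $\mathcal{K}(H)$ is the ideal of compact operators. The spaces $H_0,H_1,H_2$ are closed subspaces of $H$, possibly finite dimensional or $\{0\}$; when one is $\{0\}$ the corresponding blocks are absent. *)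

(* Defs.v *)
From HB Require Import structures.
From mathcomp Require Import all_boot all_order all_algebra.
From mathcomp Require Import all_classical all_reals all_analysis.
From mathcomp Require Export complex.

Set Implicit Arguments.
Unset Strict Implicit.
Unset Printing Implicit Defensive.

Import Order.TTheory GRing.Theory Num.Theory Num.Def.
Import numFieldNormedType.Exports.

Local Open Scope classical_set_scope.
Local Open Scope complex_scope.
Local Open Scope ring_scope.

(* Norms of complex normed modules take values in R[i] (in its nonnegative
   reals). The inner product is linear in its first argument. *)
HB.mixin Record isHilbert (R : realType) H
    & CompleteNormedModule R[i] H := {
  dot : {dot H for (@conjC R[i])} ;
  dot_norm : forall x : H, dot x x = `|x| ^+ 2
}.

#[short(type="hilbertType")]
HB.structure Definition Hilbert (R : realType) :=
  {H of CompleteNormedModule R[i] H & isHilbert R H}.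

Section ClosedSubspace.
Context {R : realType} {H : hilbertType R}.

Record closedSubspace := ClosedSubspace {
  csub_set : set H ;
  csub_set0 : csub_set 0 ;
  csub_set_linear :
    forall (a : R[i]) x y, csub_set x -> csub_set y -> csub_set (a *: x + y) ;
  csub_set_closed : closed csub_set
}.

Variable M : closedSubspace.

Definition csub_pred : {pred H} := fun x => x \in csub_set M.

Record csub_sort := CSub { csub_val : H ; csub_valP : csub_val \in csub_pred }.

HB.instance Definition _ := [isSub for csub_val].
HB.instance Definition _ := [Choice of csub_sort by <:].

Fact csub_pred_submod : submod_closed csub_pred.
Proof.
split; first by apply/mem_set; exact: csub_set0.
by move=> a x y /set_mem xM /set_mem yM; apply/mem_set; exact: csub_set_linear.
Qed.
HB.instance Definition _ :=
  GRing.isSubmodClosed.Build R[i] H csub_pred csub_pred_submod.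
HB.instance Definition _ := [SubChoice_isSubLmodule of csub_sort by <:].

Fact csub_normD (x y : csub_sort) :
  `|csub_val (x + y)| <= `|csub_val x| + `|csub_val y|.
Proof. exact: ler_normD. Qed.
Fact csub_normZ (a : R[i]) (x : csub_sort) :
  `|csub_val (a *: x)| = `|a| * `|csub_val x|.
Proof. exact: normrZ. Qed.
Fact csub_norm_eq0 (x : csub_sort) : `|csub_val x| = 0 -> x = 0.
Proof. by move=> /normr0_eq0 x0; apply: val_inj. Qed.

HB.instance Definition _ := Lmodule_isNormed.Build R[i] csub_sort
  csub_normD csub_normZ csub_norm_eq0.

Fact csub_complete (F : set_system csub_sort) :
  ProperFilter F -> cauchy F -> cvg F.
Proof.
move=> FF Fc.
have /cvg_ex[l Fl] : cvg (csub_val @ F).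
  apply/cauchy_cvgP/cauchy_ballP => e e0; near_simpl.
  have /(_ _ e e0) := iffRL (@cauchy_ballP R[i] csub_sort F _) Fc.
  by rewrite -!ball_normE.
have lM : csub_set M l.
  apply: (closed_cvg _ (@csub_set_closed M) _ _ Fl).
  by apply: filterE => x; exact/set_mem/(csub_valP x).
apply/cvg_ex; exists (CSub (mem_set lM : l \in csub_pred)).
apply/cvgrPdist_lt => e e0.
by move/cvgrPdist_lt: Fl => /(_ e e0).
Qed.

HB.instance Definition _ := Uniform_isComplete.Build csub_sort csub_complete.

Definition csub_dot (x y : csub_sort) : R[i] := dot (csub_val x) (csub_val y).

Fact csub_dot_bilinear :
  bilinear_for (@GRing.mul R[i]) (conjC \; @GRing.mul R[i]) csub_dot.
Proof.
split=> [y a x x'|x a y y']; first exact: (linearPl dot).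
exact: (linearPr dot).
Qed.
HB.instance Definition _ := bilinear_isBilinear.Build R[i]
  csub_sort csub_sort R[i] (@GRing.mul R[i]) (conjC \; @GRing.mul R[i])
  csub_dot csub_dot_bilinear.

Fact csub_dot_hermitian (x y : csub_sort) :
  csub_dot x y = (-1) ^+ false * conjC (csub_dot y x).
Proof. exact: hermC. Qed.
HB.instance Definition _ := isHermitianSesquilinear.Build R[i] csub_sort
  false conjC csub_dot csub_dot_hermitian.

Fact csub_dot_gt0 (x : csub_sort) : x != 0 -> 0 < csub_dot x x.
Proof.
move=> x0; apply: (neq0_dnorm_gt0 (s := dot)).
by apply: contra_neq x0 => vx0; apply: val_inj.
Qed.
HB.instance Definition _ := isDotProduct.Build R[i] csub_sort
  csub_dot csub_dot_gt0.

Fact csub_dot_norm (x : csub_sort) : csub_dot x x = `|x| ^+ 2.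
Proof. exact: dot_norm. Qed.
HB.instance Definition _ := isHilbert.Build R csub_sort
  csub_dot_norm.

End ClosedSubspace.
Arguments closedSubspace {R} H.
Arguments csub_val {R H M} _.
Coercion csub_sort : closedSubspace >-> Sortclass.

Section BoundedOperator.
Context {R : realType} {E F : hilbertType R}.

Definition bop_pred : {pred E -> F} :=
  fun f => `[< linear f /\ continuous f >].

Record bop := Bop { bop_fun :> E -> F ; bopP : bop_fun \in bop_pred }.

HB.instance Definition _ := [isSub for bop_fun].
HB.instance Definition _ := [Choice of bop by <:].

Fact bop_pred_submod : submod_closed bop_pred.
Proof.
split.
  apply/asboolP; split=> [a x y|]; last exact: cst_continuous.
  by rewrite /= scaler0 addr0.
move=> a f g /asboolP[lf cf] /asboolP[lg cg]; apply/asboolP; split.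
  move=> b x y; rewrite !fctE /= lf lg !scalerDr !scalerA (mulrC a b).
  by rewrite -!addrA; congr (_ + _); rewrite !addrA; congr (_ + _); rewrite addrC.
move=> x; apply: cvgD; last exact: cg.
by apply: cvgZl_tmp; exact: cf.
Qed.
HB.instance Definition _ :=
  GRing.isSubmodClosed.Build R[i] (E -> F) bop_pred bop_pred_submod.
HB.instance Definition _ := [SubChoice_isSubLmodule of bop by <:].

Fact bop_linear (T : bop) : linear T.
Proof. by have /asboolP[] := bopP T. Qed.
HB.instance Definition _ (T : bop) :=
  GRing.isLinear.Build R[i] E F _ T (bop_linear T).

Lemma bop_continuous (T : bop) : continuous T.
Proof. by have /asboolP[] := bopP T. Qed.

Lemma bop_ext (S T : bop) : S =1 T -> S = T.
Proof. by move=> ST; apply: val_inj; apply/funext. Qed.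

Definition opnorm (T : bop) : R :=
  sup [set complex.Re `|T x| | x in [set x : E | `|x| <= 1]].

Local Lemma normRe (V : normedModType R[i]) (v : V) :
  `|v| = (complex.Re `|v|)%:C.
Proof. by rewrite RRe_real// normr_real. Qed.

Lemma opnorm_has_sup (T : bop) :
  has_sup [set complex.Re `|T x| | x in [set x : E | `|x| <= 1]].
Proof.
split; first by exists (complex.Re `|T 0|), 0 => //=; rewrite normr0 ler01.
have /linear_bounded_continuous/linear_boundedP/pinfty_ex_gt0 [r r0 Tr] :=
  @bop_continuous T.
exists (complex.Re r) => _ [x /= x1 <-].
rewrite -lecR -normRe RRe_real ?gtr0_real// (le_trans (Tr x))//.
by rewrite ler_piMr// ltW.
Qed.

Lemma opnorm_ub (T : bop) (x : E) : `|x| <= 1 -> complex.Re `|T x| <= opnorm T.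
Proof. by move=> x1; apply: sup_upper_bound; [exact: opnorm_has_sup|exists x]. Qed.

Lemma opnorm_le (T : bop) (M : R) :
  (forall x, `|x| <= 1 -> complex.Re `|T x| <= M) -> opnorm T <= M.
Proof.
move=> TM; apply: sup_le_ub; first by case: (opnorm_has_sup T).
by move=> _ [x /= x1 <-]; exact: TM.
Qed.

Lemma opnorm_ge0 (T : bop) : 0 <= opnorm T.
Proof.
apply: (@le_trans _ _ (complex.Re `|T 0|)); last first.
  by apply: opnorm_ub; rewrite normr0 ler01.
by rewrite -lecR -normRe; exact: normr_ge0.
Qed.

Fact opnormD (S T : bop) :
  (opnorm (S + T))%:C <= (opnorm S)%:C + (opnorm T)%:C.
Proof.
rewrite -rmorphD lecR; apply: opnorm_le => x x1.
apply: le_trans (lerD (opnorm_ub S x1) (opnorm_ub T x1)).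
by rewrite -lecR rmorphD/= -!normRe; exact: ler_normD.
Qed.

Local Lemma opnormZ_le (a : R[i]) (T : bop) :
  opnorm (a *: T) <= complex.Re `|a| * opnorm T.
Proof.
apply: opnorm_le => x x1.
have -> : complex.Re `|(a *: T) x| = complex.Re `|a| * complex.Re `|T x|.
  have -> : `|(a *: T) x| = `|a| * `|T x| by exact: normrZ.
  by rewrite -[`|a|]RRe_real ?normr_real// (normRe (T x)) -rmorphM.
rewrite ler_wpM2l ?opnorm_ub// -lecR RRe_real ?normr_real//.
exact: normr_ge0.
Qed.

Fact opnormZ (a : R[i]) (T : bop) :
  (opnorm (a *: T))%:C = `|a| * (opnorm T)%:C.
Proof.
have Ea : `|a| = (complex.Re `|a|)%:C by rewrite RRe_real// normr_real.
rewrite {1}Ea -rmorphM; congr (_%:C); apply/eqP; rewrite eq_le opnormZ_le andTb.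
have [->|a0] := eqVneq a 0.
  rewrite normr0 raddf0 mul0r.
  exact: opnorm_ge0.
have := opnormZ_le a^-1 (a *: T); rewrite scalerA mulVf// scale1r => h.
have a0' : 0 < complex.Re `|a| by rewrite -ltcR -Ea normr_gt0.
rewrite mulrC -ler_pdivlMr// (le_trans h)// mulrC ler_wpM2l//.
  exact: opnorm_ge0.
suff -> : `|a^-1| = ((complex.Re `|a|)^-1)%:C by [].
by rewrite normfV {1}Ea; exact: (esym (fmorphV (real_complex R) _)).
Qed.

Fact opnorm_eq0 (T : bop) : (opnorm T)%:C = 0 -> T = 0.
Proof.
move=> /complexI T0; apply: bop_ext => x.
have [->|x0] := eqVneq x 0; first by rewrite linear0.
have x1 : `|(`|x|^-1 *: x)| <= 1 by rewrite normfZV.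
have := opnorm_ub T x1; rewrite T0 -lecR -normRe linearZ/= normrZ.
rewrite pmulr_rle0 ?normr_le0; last by rewrite normr_gt0 invr_eq0 normr_eq0.
by move/eqP.
Qed.

HB.instance Definition _ := Lmodule_isNormed.Build R[i] bop
  opnormD opnormZ opnorm_eq0.

Lemma bop_normE (T : bop) : `|T| = (opnorm T)%:C.
Proof. by []. Qed.

End BoundedOperator.
Arguments bop {R} E F.

Section Algebra.
Context {R : realType}.

Fact idop_subproof (E : hilbertType R) : (id : E -> E) \in bop_pred.
Proof. by apply/asboolP; split=> // x; exact: cvg_id. Qed.
Definition idop (E : hilbertType R) : bop E E := Bop (idop_subproof E).

Fact compop_subproof (E F G : hilbertType R) (S : bop F G) (T : bop E F) :
  (S \o T) \in bop_pred.
Proof.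
apply/asboolP; split=> [a x y|x]; first by rewrite /= !linearP.
by apply: continuous_comp; exact: bop_continuous.
Qed.
Definition compop (E F G : hilbertType R) (S : bop F G) (T : bop E F) :
  bop E G := Bop (compop_subproof S T).

Fact isometry_continuous (E F : hilbertType R) (f : E -> F) :
  (forall x y, `|f x - f y| = `|x - y|) -> continuous f.
Proof.
move=> fi x; apply/cvgrPdist_lt => e e0.
by apply: filterS (nbhsx_ballx x e e0) => y; rewrite -ball_normE /= fi.
Qed.

Fact inclop_subproof (H : hilbertType R) (M : closedSubspace H) :
  (@csub_val R H M) \in bop_pred.
Proof. by apply/asboolP; split; last exact: isometry_continuous. Qed.
Definition inclop (H : hilbertType R) (M : closedSubspace H) : bop M H :=
  Bop (inclop_subproof M).

End Algebra.
Notation "S \oB T" := (compop S T) (at level 40, left associativity) : ring_scope.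

Section NullSpace.
Context {R : realType} {E F : hilbertType R} (T : bop E F).

Fact null_space0 : [set x | T x = 0] 0.
Proof. exact: linear0. Qed.

Fact null_space_linear (a : R[i]) x y :
  [set x | T x = 0] x -> [set x | T x = 0] y -> [set x | T x = 0] (a *: x + y).
Proof. by move=> /= x0 y0; rewrite linearP/= x0 y0 scaler0 addr0. Qed.

Fact null_space_closed : closed [set x | T x = 0].
Proof.
have -> : [set x | T x = 0] = T @^-1` [set 0] by [].
apply: preimage_closed; first by move=> x _; exact: bop_continuous.
exact/accessible_closed_set1/hausdorff_accessible/norm_hausdorff.
Qed.

Definition null_space : closedSubspace E :=
  ClosedSubspace null_space0 null_space_linear null_space_closed.

End NullSpace.

Section Operators.
Context {R : realType}.
Implicit Types E F H : hilbertType R.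

(* T^* and |T| = (T^* T)^(1/2) are the unique operators in the sets below; the
   default value of xget is never used, since both exist (Riesz representation
   and the square root of a positive operator). *)

Definition adjoint E F (T : bop E F) : bop F E :=
  xget (0 : bop F E) [set S : bop F E | forall x y, dot (T x) y = dot x (S y)].

Definition positive_op E (T : bop E E) := forall x, 0 <= dot (T x) x.

Definition le_op E (S T : bop E E) := positive_op (T - S).

Definition absop E F (T : bop E F) : bop E E :=
  xget (0 : bop E E)
    [set P : bop E E | positive_op P /\ P \oB P = adjoint T \oB T].

Definition isometric_op E F (T : bop E F) := forall x, `|T x| = `|x|.

Definition unitary_op E (T : bop E E) :=
  adjoint T \oB T = idop E /\ T \oB adjoint T = idop E.

Definition star_paranormal H (T : bop H H) :=
  forall x, `|adjoint T x| ^+ 2 <= `|T (T x)| * `|x|.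

Definition absolutely_norm_attaining H : set (bop H H) :=
  [set T : bop H H | forall L : closedSubspace H, (exists x : L, x != 0) ->
     exists2 x : L, `|x| = 1 & `|T (csub_val x)| = `|T \oB inclop L|].

Definition infinite_dimensional H :=
  ~ exists s : seq H, forall x : H,
      exists c : nat -> R[i], x = \sum_(i < size s) c i *: s`_i.

Definition invertible_op E (T : bop E E) :=
  exists S : bop E E, S \oB T = idop E /\ T \oB S = idop E.

Definition spectrum E (T : bop E E) : set R[i] :=
  [set z | ~ invertible_op (T - z *: idop E)].

Definition compact_op E F (T : bop E F) :=
  precompact (T @` [set x | `|x| <= 1]).

(* The image of T in the Calkin algebra, as a coset of the compact operators;
   its product is induced by composition. *)
Definition calkin E (T : bop E E) : set (bop E E) :=
  [set S | compact_op (S - T)].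

Definition essential_spectrum E (T : bop E E) : set R[i] :=
  [set z | ~ exists S : bop E E,
     calkin (S \oB (T - z *: idop E)) = calkin (idop E) /\
     calkin ((T - z *: idop E) \oB S) = calkin (idop E)].

End Operators.

Section Decompositions.
Context {R : realType} {H : hilbertType R}.

Definition orthogonal_spaces (M N : closedSubspace H) :=
  forall (x : M) (y : N), dot (csub_val x) (csub_val y) = 0.

Definition orthogonal_complement (A : set H) : set H :=
  [set x | forall y, A y -> dot x y = 0].

Definition sum_set (A B : set H) : set H := [set x + y | x in A & y in B].

Definition orthogonal_decomposition3 (H0 H1 H2 : closedSubspace H) :=
  [/\ orthogonal_spaces H0 H1, orthogonal_spaces H0 H2, orthogonal_spaces H1 H2 &
      forall x : H, exists (x0 : H0) (x1 : H1) (x2 : H2),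
        x = csub_val x0 + csub_val x1 + csub_val x2].

Definition block_matrix3 (H0 H1 H2 : closedSubspace H) (T : bop H H)
    (T00 : bop H0 H0) (T01 : bop H1 H0) (T02 : bop H2 H0)
    (T10 : bop H0 H1) (T11 : bop H1 H1) (T12 : bop H2 H1)
    (T20 : bop H0 H2) (T21 : bop H1 H2) (T22 : bop H2 H2) :=
  forall (x0 : H0) (x1 : H1) (x2 : H2),
    T (csub_val x0 + csub_val x1 + csub_val x2) =
      csub_val (T00 x0 + T01 x1 + T02 x2) +
      csub_val (T10 x0 + T11 x1 + T12 x2) +
      csub_val (T20 x0 + T21 x1 + T22 x2).

(* A number n in N u {oo} is an [option nat], with oo = None; the indices
   i = 1, .., n are shifted to i = 0, .., n - 1. *)
Definition index_set (n : option nat) : set nat :=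
  if n is Some m then [set i | (i < m)%N] else setT.

Definition algebraic_sum (I : set nat) (N : nat -> closedSubspace H) : set H :=
  [set x | exists (m : nat) (c : nat -> H),
     (forall i, I i -> csub_set (N i) (c i)) /\
     x = \sum_(i < m | `[< I i >]) c i].

Definition hilbert_sum (I : set nat) (N : nat -> closedSubspace H)
    (M : closedSubspace H) :=
  (forall i j, I i -> I j -> i <> j -> orthogonal_spaces (N i) (N j)) /\
  csub_set M = closure (algebraic_sum I N).

Definition hilbert_sum_op (I : set nat) (N : nat -> closedSubspace H)
    (S : forall i, bop (N i) (N i)) (M : closedSubspace H) (V : bop M M) :=
  hilbert_sum I N M /\
  forall i, I i -> forall (x : N i) (y : M), csub_val y = csub_val x ->
    csub_val (V y) = csub_val (S i x).

End Decompositions.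
Arguments absolutely_norm_attaining {R} H _.

(* Main.v *)
(* If S is absolutely norm attaining, then on some finite-codimensional subspaces
   |S x|^2 / |x|^2 oscillates arbitrarily little; this passes to norm limits, so
   T^*T - lambda^2, and hence |T| - lambda, is compact. The spectrum of |T| above
   lambda then consists of eigenvalues accumulating at most at lambda. Going down
   these eigenvalues a, on the orthogonal complement of the larger eigenspaces
   |T x| <= a |x|, and for x in the eigenspace *-paranormality at T x gives
   |T (T x)| >= a |T x|, so that T x is again an eigenvector. For a > lambda,
   compactness makes T onto the eigenspace, which therefore reduces T. At a =
   lambda only invariance remains, whence the triangular block. If x is orthogonal
   to all these eigenspaces, then T^* x = B^* x and
   |B^* x|^2 <= |T^2 x| |x| <= lambda^2 |x|^2, which gives the last inequality. *)

Require Import Defs.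
From mathcomp Require Import all_boot all_order all_algebra.
From mathcomp Require Import all_classical all_reals all_analysis.
From mathcomp Require Import ring lra.
Set Implicit Arguments.
Unset Strict Implicit.
Unset Printing Implicit Defensive.
Import Order.TTheory GRing.Theory Num.Theory.
Import numFieldNormedType.Exports.
Local Open Scope classical_set_scope.
Local Open Scope complex_scope.
Local Open Scope ring_scope.

(** * Hilbert spaces: projections, adjoints and square roots *)

(** No spectral measure is used. If $|Px|$ is almost maximal among the unit vectors of a
    [P]-invariant subspace, where [P = absop T], then [pos_defect] and [pos_shift_le] make $x$ an
    approximate eigenvector, and compactness of [P - lam] yields a true one. Compactness is read as
    smallness on the orthogonal complement of a finite list: the closure hypothesis delivers it in
    this shape, and lengthening the list turns a bound on a quadratic form into one on an operator.
    The descent cannot follow the enumeration [alpha], whose order is arbitrary. Instead, only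
    finitely many eigenvalues lie above a given [a > lam], so a failure of reduction would have a
    largest instance. Surjectivity is what gives invariance under $T^*$: on the eigenspace $T^*T =
    a^2$, so $T^*$ sends $Ty$ to $a^2 y$, and every vector of the eigenspace has to be such a $Ty$.
    The value [lam = 0] stands apart: $T$ then vanishes on the complement of $H_0$, which forces
    $H_2 = 0$, and $\lambda V = 0$ does not determine [V]. *)

Definition nm {R : realType} {H : hilbertType R} (x : H) : R :=
  complex.Re `|x|.

Section RealNorm.
Context {R : realType} {H : hilbertType R}.
Implicit Types x y z : H.

Lemma nmE x : `|x| = (nm x)%:C.
Proof. by rewrite /nm RRe_real// normr_real. Qed.

Lemma nm_ge0 x : 0 <= nm x.
Proof. by rewrite -lecR -nmE; exact: normr_ge0. Qed.

Lemma nm0 : nm (0 : H) = 0.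
Proof. by rewrite /nm normr0. Qed.

Lemma nm_eq0 x : nm x = 0 -> x = 0.
Proof. by move=> x0; apply: normr0_eq0; rewrite nmE x0. Qed.

Lemma nm_gt0 x : x != 0 -> 0 < nm x.
Proof.
move=> x0; rewrite lt_neqAle nm_ge0 andbT.
by apply: contra_neq x0 => /esym; exact: nm_eq0.
Qed.

Lemma nmD x y : nm (x + y) <= nm x + nm y.
Proof. by rewrite -lecR rmorphD/= -!nmE; exact: ler_normD. Qed.

Lemma nmZ (a : R[i]) x : nm (a *: x) = complex.Re `|a| * nm x.
Proof.
have aE : `|a| = (complex.Re `|a|)%:C by rewrite RRe_real// normr_real.
by apply: complexI; rewrite -nmE normrZ {1}aE nmE -rmorphM.
Qed.

Lemma nmZr (a : R) x : nm (a%:C *: x) = `|a| * nm x.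
Proof. by rewrite nmZ; congr (_ * _); rewrite normc_def/= expr0n/= addr0 sqrtr_sqr. Qed.

Lemma nmN x : nm (- x) = nm x.
Proof. by rewrite /nm normrN. Qed.

Lemma nmB x y : nm (x - y) = nm (y - x).
Proof. by rewrite -nmN opprB. Qed.

Lemma nm_leB x y z : nm (x - z) <= nm (x - y) + nm (y - z).
Proof. by apply: le_trans (nmD _ _); rewrite addrA subrK. Qed.

End RealNorm.

(** Variations along real parameters only see this real inner product; [dot_eq0] recovers the
    complex one by testing against ['i *: y] as well. *)
Definition rd {R : realType} {H : hilbertType R} (x y : H) : R :=
  complex.Re (dot x y).

Section RealDot.
Context {R : realType} {H : hilbertType R}.
Implicit Types x y z : H.

Lemma dotC x y : dot x y = conjc (dot y x).
Proof. by rewrite (hermC (@dot R H)) expr0 mul1r. Qed.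

Lemma dotDl x y z : dot (x + y) z = dot x z + dot y z.
Proof. exact: (linearDl (@dot R H)). Qed.
Lemma dotDr x y z : dot x (y + z) = dot x y + dot x z.
Proof. exact: (linearDr (@dot R H)). Qed.
Lemma dotBl x y z : dot (x - y) z = dot x z - dot y z.
Proof. exact: (linearBl (@dot R H)). Qed.
Lemma dotBr x y z : dot x (y - z) = dot x y - dot x z.
Proof. exact: (linearBr (@dot R H)). Qed.
Lemma dotZl a x y : dot (a *: x) y = a * dot x y.
Proof. exact: (linearZl_LR (@dot R H)). Qed.
Lemma dotZr a x y : dot x (a *: y) = conjc a * dot x y.
Proof. exact: (linearZr_LR (@dot R H)). Qed.
Lemma dot0l y : dot (0 : H) y = 0.
Proof. exact: (linear0l (@dot R H)). Qed.
Lemma dot0r y : dot y (0 : H) = 0.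
Proof. exact: (linear0r (@dot R H)). Qed.

Lemma dot_suml n (u : 'I_n -> H) y : dot (\sum_i u i) y = \sum_i dot (u i) y.
Proof. by apply: (big_morph (fun x => dot x y)) => [a b|]; rewrite ?dotDl ?dot0l. Qed.
Lemma dot_sumr n (u : 'I_n -> H) y : dot y (\sum_i u i) = \sum_i dot y (u i).
Proof. by apply: (big_morph (fun x => dot y x)) => [a b|]; rewrite ?dotDr ?dot0r. Qed.

Lemma dotxx x : dot x x = (nm x ^+ 2)%:C.
Proof. by rewrite dot_norm nmE rmorphXn. Qed.

Lemma rdxx x : rd x x = nm x ^+ 2.
Proof. by rewrite /rd dotxx. Qed.

Lemma rdC x y : rd x y = rd y x.
Proof. by rewrite /rd dotC; case: (dot y x). Qed.

Lemma rdDl x y z : rd (x + y) z = rd x z + rd y z.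
Proof. by rewrite /rd dotDl raddfD. Qed.
Lemma rdDr x y z : rd x (y + z) = rd x y + rd x z.
Proof. by rewrite /rd dotDr raddfD. Qed.
Lemma rdBl x y z : rd (x - y) z = rd x z - rd y z.
Proof. by rewrite /rd dotBl raddfB. Qed.
Lemma rdBr x y z : rd x (y - z) = rd x y - rd x z.
Proof. by rewrite /rd dotBr raddfB. Qed.
Lemma rdZl a x y : rd (a%:C *: x) y = a * rd x y.
Proof. by rewrite /rd dotZl; case: (dot x y) => u v /=; rewrite mul0r subr0. Qed.
Lemma rdZr a x y : rd x (a%:C *: y) = a * rd x y.
Proof. by rewrite rdC rdZl rdC. Qed.

Lemma rd_eq0 x y : dot x y = 0 -> rd x y = 0.
Proof. by rewrite /rd => ->. Qed.

Lemma dot_eq0C x y : dot x y = 0 -> dot y x = 0.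
Proof. by rewrite dotC => xy; apply: (inv_inj (@conjcK R)); rewrite xy conjc0. Qed.

Lemma dot_eq0 x y : rd x y = 0 -> rd x ('i *: y) = 0 -> dot x y = 0.
Proof.
rewrite /rd dotZr; case: (dot x y) => u v /= -> .
by rewrite /= mul0r sub0r mulN1r opprK => ->.
Qed.

Lemma nmD_sqr x y : nm (x + y) ^+ 2 = nm x ^+ 2 + 2 * rd x y + nm y ^+ 2.
Proof. by rewrite -rdxx !(rdDl, rdDr) !rdxx (rdC y x); ring. Qed.

Lemma nmB_sqr x y : nm (x - y) ^+ 2 = nm x ^+ 2 - 2 * rd x y + nm y ^+ 2.
Proof. by rewrite -rdxx !(rdBl, rdBr) !rdxx (rdC y x); ring. Qed.

(** Cauchy-Schwarz, read off by squaring the triangle inequality, which the normed structure already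
    supplies. *)
Lemma rd_le x y : rd x y <= nm x * nm y.
Proof.
have := nm_ge0 x; have := nm_ge0 y.
have := nmD_sqr x y; have := nmD x y; have := nm_ge0 (x + y).
nra.
Qed.

Lemma rd_abs x y : `|rd x y| <= nm x * nm y.
Proof.
rewrite ler_norml rd_le andbT lerNl -(nmN x).
by have := rd_le (- x) y; rewrite -{1}(scaleN1r x) -(rmorphN1 (real_complex R)) rdZl mulN1r.
Qed.

Lemma dot_ext x y : (forall z, dot z x = dot z y) -> x = y.
Proof.
move=> xy; apply/eqP; rewrite -subr_eq0; apply/eqP/nm_eq0/eqP.
by rewrite -sqrf_eq0 -rdxx /rd dotBr xy subrr.
Qed.

End RealDot.

(** First-order condition at a minimum. At $t = r/(q+1)$ (the $+1$ covers $q = 0$) the expression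
    equals $-r^2(w + w^2)$ with $w = 1/(q+1)$. *)
Lemma quad_lin_eq0 (R : realType) (q r : R) : 0 <= q ->
  (forall t, 0 <= t ^+ 2 * q - 2 * t * r) -> r = 0.
Proof.
move=> q0 /(_ (r / (q + 1))) h.
have q1 : 0 < q + 1 by rewrite ltr_wpDl.
have := mulVf (lt0r_neq0 q1); move: h; have : 0 < (q + 1)^-1 by rewrite invr_gt0.
move: (_^-1) => w w0 h qw.
have h2 : (r * w) ^+ 2 * q - 2 * (r * w) * r = r ^+ 2 * (w * (w * (q + 1)) - w ^+ 2 - 2 * w).
  by ring.
move: h; rewrite h2 qw mulr1 => h.
have w2 : 0 < w + w ^+ 2 by rewrite addr_gt0// exprn_gt0.
by apply/eqP; rewrite -sqrf_eq0 eq_le sqr_ge0 andbT -(pmulr_lle0 _ w2); lra.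
Qed.

Section BoundedOperators.
Context {R : realType}.
Implicit Types E F G H : hilbertType R.

Lemma bopDE E F (S T : bop E F) x : (S + T) x = S x + T x.
Proof. by []. Qed.
Lemma bopBE E F (S T : bop E F) x : (S - T) x = S x - T x.
Proof. by []. Qed.
Lemma bopZE E F a (T : bop E F) x : (a *: T) x = a *: T x.
Proof. by []. Qed.
Lemma bop0E E F x : (0 : bop E F) x = 0.
Proof. by []. Qed.

Lemma bopB E F (T : bop E F) x y : T (x - y) = T x - T y.
Proof. exact: linearB. Qed.
Lemma bopD E F (T : bop E F) x y : T (x + y) = T x + T y.
Proof. exact: linearD. Qed.
Lemma bopZ E F (T : bop E F) a x : T (a *: x) = a *: T x.
Proof. exact: linearZ. Qed.

Lemma nm_le1 E (x : E) : (`|x| <= 1) = (nm x <= 1).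
Proof. by rewrite nmE (lecR (nm x) 1). Qed.

Lemma opnormP E F (T : bop E F) x : nm (T x) <= opnorm T * nm x.
Proof.
have [->|x0] := eqVneq x 0; first by rewrite linear0 !nm0 mulr0.
have x0' := nm_gt0 x0.
have := @opnorm_ub _ _ _ T ((nm x)^-1%:C *: x).
rewrite bopZ nm_le1 -/(nm _) !nmZr gtr0_norm ?invr_gt0// mulVf ?gt_eqF//.
by move=> /(_ (lexx _)); rewrite mulrC ler_pdivrMr.
Qed.

Lemma realC_gt0 (e : R[i]) : 0 < e -> exists2 d : R, 0 < d & e = d%:C.
Proof.
by case: e => d y; rewrite ltcE/= => /andP[/eqP -> d0]; exists d.
Qed.

Lemma bounded_bop E F (f : E -> F) (C : R) :
  linear f -> (forall x, nm (f x) <= C * nm x) -> f \in bop_pred.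
Proof.
move=> fl fC; apply/asboolP; split=> // x.
have C1 : 0 < `|C| + 1 by rewrite ltr_wpDl.
apply/cvgrPdist_lt => _ /realC_gt0[e e0 ->].
have d0 : 0 < (e / (`|C| + 1))%:C by rewrite (ltcR 0) divr_gt0.
apply: filterS (nbhsx_ballx x _ d0) => y; rewrite -ball_normE /= !nmE !ltcR.
have -> : f x - f y = f (x - y).
  by rewrite -(scaleN1r y) (addrC x) fl scaleN1r addrC.
rewrite ltr_pdivlMr// => xye; apply: le_lt_trans (fC _) (le_lt_trans _ xye).
rewrite mulrC ler_wpM2l ?nm_ge0//.
by apply: le_trans (ler_norm C) _; rewrite lerDl.
Qed.

Definition mkbop E F (f : E -> F) (C : R) (fl : linear f)
  (fC : forall x, nm (f x) <= C * nm x) : bop E F := Bop (bounded_bop fl fC).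

Lemma cauchy_nm E (u : nat -> E) :
  (forall e : R, 0 < e -> exists N, forall m n,
     (N <= m)%N -> (N <= n)%N -> nm (u m - u n) < e) ->
  exists l : E, u @ \oo --> l.
Proof.
move=> uc; apply/cvg_ex/cauchy_cvgP/cauchy_ballP => _ /realC_gt0[e e0 ->].
have [N Nu] := uc e e0.
exists ([set u n | n in [set n | (N <= n)%N]],
        [set u n | n in [set n | (N <= n)%N]]) => /=.
  by split; exists N => // n /= Nn; exists n.
move=> [_ _] [/= [m Nm <-] [n Nn <-]].
by rewrite -ball_normE/= nmE ltcR; exact: Nu.
Qed.

Lemma cvg_nm E (u : nat -> E) (l : E) : u @ \oo --> l ->
  forall e : R, 0 < e -> exists N, forall n, (N <= n)%N -> nm (u n - l) < e.
Proof.
move=> /cvgrPdist_lt ul e e0.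
have [|N _ Nu] := ul e%:C; first by rewrite (ltcR 0).
by exists N => n /Nu /=; rewrite nmE ltcR nmB.
Qed.

Lemma nm_cvg E (u : nat -> E) (l : E) :
  (forall e : R, 0 < e -> exists N, forall n, (N <= n)%N -> nm (u n - l) < e) ->
  u @ \oo --> l.
Proof.
move=> ul; apply/cvgrPdist_lt => _ /realC_gt0[e e0 ->].
have [N Nu] := ul e e0.
by exists N => // n /Nu /=; rewrite nmE ltcR nmB.
Qed.

Lemma half_double E (x : E) : (2^-1 : R)%:C *: (x + x) = x.
Proof.
have -> : x + x = (2 : R)%:C *: x by rewrite rmorph_nat scaler_nat mulr2n.
by rewrite scalerA -rmorphM mulVf ?pnatr_eq0// scale1r.
Qed.

(* With A an inclusion this is the projection theorem; with A self-adjoint it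
   says that A is onto. *)
Lemma least_squares E F (A : bop E F) (c : R) (z : F) :
  0 < c -> (forall x, c * nm x <= nm (A x)) ->
  exists x : E, forall y, dot (z - A x) (A y) = 0.
Proof.
move=> c0 Ac.
pose D := [set nm (z - A x) ^+ 2 | x in [set: E]].
have D0 : has_inf D.
  split; first by exists (nm (z - A 0) ^+ 2), 0.
  by exists 0 => _ [x _ <-]; exact: sqr_ge0.
have infD x : inf D <= nm (z - A x) ^+ 2 by apply: ge_inf; [case: D0|exists x].
have near_inf (n : nat) : exists x, nm (z - A x) ^+ 2 < inf D + n.+1%:R^-1.
  have [|_ [x _ <-] xn] := @inf_adherent _ D n.+1%:R^-1 _ D0.
    by rewrite invr_gt0 ltr0n.
  by exists x.
have [u uP] := choice near_inf.
(* parallelogram law *)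
have upar m n :
    nm (A (u m - u n)) ^+ 2 <= 2 * (m.+1%:R^-1 + n.+1%:R^-1).
  have := infD ((2^-1)%:C *: (u m + u n)).
  have := uP m; have := uP n.
  have -> : A (u m - u n) = (z - A (u n)) - (z - A (u m)).
    by rewrite bopB opprB [RHS]addrC addrA subrK.
  have -> : z - A ((2^-1)%:C *: (u m + u n)) =
      (2^-1)%:C *: ((z - A (u n)) + (z - A (u m))).
    rewrite bopZ bopD addrACA -opprD scalerBr (addrC (A (u n))).
    by rewrite half_double.
  move: (z - A (u n)) (z - A (u m)) => v w.
  rewrite nmZr exprMn nmB_sqr nmD_sqr ger0_norm ?invr_ge0//.
  have -> : (2^-1 : R) ^+ 2 = 4^-1 by field.
  move: (rd v w) (nm v ^+ 2) (nm w ^+ 2) (m.+1%:R^-1 : R) (n.+1%:R^-1 : R) => *. lra.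
have [|x /cvg_nm xP] := @cauchy_nm _ u.
  move=> e e0.
  have ce0 : 0 < (c * e) ^+ 2 / 4 by rewrite divr_gt0// exprn_gt0// mulr_gt0.
  have [N /= Ne] := @near_infty_natSinv_lt R (PosNum ce0).
  move=> Nlt; exists N => m n /Nlt Hm /Nlt Hn; move: Hm Hn => /= Hm Hn.
  rewrite -(ltr_pM2l c0); apply: le_lt_trans (Ac _) _.
  rewrite -(ltr_pXn2r (_ : 0 < 2)%N) ?nnegrE ?nm_ge0 ?mulr_ge0 ?ltW//.
  apply: le_lt_trans (upar _ _) _; move: Hm Hn.
  move: ((c * e) ^+ 2) (m.+1%:R^-1 : R) (n.+1%:R^-1 : R) => a b d *; lra.
exists x => y.
have xmin : nm (z - A x) ^+ 2 <= inf D.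
  apply/ler_addgt0Pr => e e0.
  set d := nm (z - A x); have d0 : 0 <= d by exact: nm_ge0.
  have i0 : 0 <= inf D.
    by apply: lb_le_inf; [case: D0|move=> _ [y' _ <-]; exact: sqr_ge0].
  (* With $s = |z - A u_n|$ one has $d^2 - s^2 = (d-s)(d+s)$, where $d - s \leq |A|\,|u_n - x|$ and
     $s \leq \inf D + 1$; [g] is the distance $|u_n - x|$ that makes this at most $e/2$. *)
  pose g := e / 2 / (d + inf D + 1) / (opnorm A + 1).
  have g0 : 0 < g by rewrite !divr_gt0// ltr_wpDl// ?opnorm_ge0// addr_ge0.
  have [N1 N1P] := xP g g0.
  have e20 : 0 < e / 2 by rewrite divr_gt0.
  have [N2 _ N2P] := @near_infty_natSinv_lt R (PosNum e20).
  pose n := maxn N1 N2.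
  have w1 : n.+1%:R^-1 <= 1 :> R by rewrite invf_le1 ?ltr0n// ler1n.
  have := N1P n (leq_maxl _ _); have := N2P n (leq_maxr _ _); have := uP n.
  have : d <= nm (z - A (u n)) + nm (A (u n - x)).
    by rewrite bopB; exact: nm_leB.
  have := opnormP A (u n - x).
  have := nm_ge0 (z - A (u n)); have := nm_ge0 (u n - x).
  have := nm_ge0 (A (u n - x)); have C0 := opnorm_ge0 A.
  have C1 : 0 < opnorm A + 1 by lra.
  have D1 : 0 < d + inf D + 1 by lra.
  rewrite /g/= !(ltr_pdivlMr _ _ C1, ltr_pdivlMr _ _ D1).
  move: (opnorm A) C0 C1 (n.+1%:R^-1 : R) w1 (nm (u n - x)) (nm (A (u n - x))).
  move: (nm (z - A (u n))) => s C C0 C1 w w1 v a a0 v0 s0 aCv ds sw we ve.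
  have sD : s <= inf D + 1 by nra.
  have ave : a * (d + inf D + 1) <= e / 2.
    apply: le_trans (ltW ve); rewrite ler_wpM2r ?addr_ge0//; nra.
  have : d ^+ 2 - s ^+ 2 <= a * (d + inf D + 1); last by lra.
  have [ds'|ds'] := leP d s.
    by apply: (@le_trans _ _ 0); [nra|rewrite mulr_ge0 ?addr_ge0].
  nra.
have H0 y' : rd (z - A x) (A y') = 0.
  have key (t : R) : 0 <= t ^+ 2 * nm (A y') ^+ 2 - 2 * t * rd (z - A x) (A y').
    have := infD (x + t%:C *: y').
    rewrite bopD bopZ opprD addrA (nmB_sqr (z - A x)) nmZr rdZr exprMn -normrX.
    by rewrite (ger0_norm (sqr_ge0 t)); move: xmin; lra.
  by apply: quad_lin_eq0 key; exact: sqr_ge0.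
by apply: dot_eq0; [exact: H0|rewrite -bopZ; exact: H0].
Qed.

End BoundedOperators.

Section Projection.
Context {R : realType}.
Implicit Types E F H : hilbertType R.

Lemma closed_nm E (A : set E) :
  (forall x, (forall e : R, 0 < e -> exists2 y, A y & nm (x - y) < e) -> A x) ->
  closed A.
Proof.
move=> AP x xA; apply: AP => e e0.
have e0' : 0 < e%:C :> R[i] by rewrite (ltcR 0).
have [y [Ay]] := xA _ (nbhsx_ballx x _ e0').
by rewrite -ball_normE/= nmE ltcR; exists y.
Qed.

Lemma closureP E (A : set E) x :
  closure A x <-> forall e : R, 0 < e -> exists2 y, A y & nm (x - y) < e.
Proof.
split=> [xA e e0|xA].
  have e0' : 0 < e%:C :> R[i] by rewrite (ltcR 0).
  have [y [Ay]] := xA _ (nbhsx_ballx x _ e0').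
  by rewrite -ball_normE/= nmE ltcR; exists y.
move=> B /nbhs_ballP[_ /= /realC_gt0[e e0 ->] xeB].
have [y Ay xy] := xA e e0; exists y; split=> //; apply: xeB.
by rewrite -ball_normE/= nmE ltcR.
Qed.

Lemma nm_lt_eq0 E (x : E) : (forall e : R, 0 < e -> nm x < e) -> x = 0.
Proof.
move=> xe; apply: nm_eq0; apply/eqP; rewrite eq_le nm_ge0 andbT.
by apply/ler_addgt0Pr => e e0; rewrite add0r ltW// xe.
Qed.

Fact perp_set0 E (A : set E) : [set x | forall y, A y -> dot x y = 0] 0.
Proof. by move=> y _; rewrite dot0l. Qed.

Fact perp_set_linear E (A : set E) (a : R[i]) x y :
  [set x | forall y, A y -> dot x y = 0] x ->
  [set x | forall y, A y -> dot x y = 0] y ->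
  [set x | forall y, A y -> dot x y = 0] (a *: x + y).
Proof.
by move=> /= xA yA z Az; rewrite dotDl dotZl xA// yA// mulr0 addr0.
Qed.

Lemma rd_closed E (x z : E) :
  (forall e : R, 0 < e -> exists2 y, rd y z = 0 & nm (x - y) < e) -> rd x z = 0.
Proof.
move=> xz; apply/eqP; rewrite -normr_le0; apply/ler_addgt0Pr => e e0.
have z1 : 0 < nm z + 1 by rewrite ltr_wpDl// nm_ge0.
have [y yz xy] := xz _ (divr_gt0 e0 z1).
rewrite add0r -[rd x z]subr0 -yz -rdBl; apply: le_trans (rd_abs _ _) _.
move: xy; rewrite ltr_pdivlMr// => /ltW; apply: le_trans.
by rewrite ler_wpM2l ?nm_ge0// lerDl.
Qed.

Fact perp_set_closed E (A : set E) :
  closed [set x | forall y, A y -> dot x y = 0].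
Proof.
apply: closed_nm => x /= xe y Ay; apply: dot_eq0; apply: rd_closed => e /xe[z zA xz];
  exists z => //; first by rewrite rd_eq0// zA.
by rewrite /rd dotZr zA// mulr0.
Qed.

Definition perp E (A : set E) : closedSubspace E :=
  ClosedSubspace (@perp_set0 E A) (@perp_set_linear E A) (@perp_set_closed E A).

Definition csub_of E (M : closedSubspace E) (x : E) (xM : csub_set M x) : M :=
  CSub (mem_set xM : x \in csub_pred M).

Lemma csub_in E (M : closedSubspace E) (x : M) : csub_set M (csub_val x).
Proof. exact/set_mem/(csub_valP x). Qed.

Lemma csubB E (M : closedSubspace E) x y :
  csub_set M x -> csub_set M y -> csub_set M (x - y).
Proof. by move=> xM yM; rewrite addrC -scaleN1r; exact: csub_set_linear. Qed.
Lemma csubD E (M : closedSubspace E) x y :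
  csub_set M x -> csub_set M y -> csub_set M (x + y).
Proof. by move=> xM yM; rewrite -(scale1r x); exact: csub_set_linear. Qed.
Lemma csubZ E (M : closedSubspace E) a x : csub_set M x -> csub_set M (a *: x).
Proof.
by move=> xM; rewrite -[a *: x]addr0; apply: csub_set_linear; last exact: csub_set0.
Qed.

Lemma csub_valD E (M : closedSubspace E) (x y : M) :
  csub_val (x + y) = csub_val x + csub_val y.
Proof. by []. Qed.
Lemma csub_valZ E (M : closedSubspace E) a (x : M) :
  csub_val (a *: x) = a *: csub_val x.
Proof. by []. Qed.
Lemma csub_nmE E (M : closedSubspace E) (x : M) : nm x = nm (csub_val x).
Proof. by []. Qed.

Lemma proj_ex E (M : closedSubspace E) (z : E) :
  {x : M | forall y : M, dot (z - csub_val x) (csub_val y) = 0}.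
Proof.
apply/cid; apply: (@least_squares _ _ _ (inclop M) 1 z ltr01) => x.
by rewrite mul1r.
Qed.

Definition projf E (M : closedSubspace E) (z : E) : M := sval (proj_ex M z).

Lemma projfP E (M : closedSubspace E) z y :
  csub_set M y -> dot (z - csub_val (projf M z)) y = 0.
Proof. by move=> yM; exact: (svalP (proj_ex M z) (csub_of yM)). Qed.

Lemma projf_unique E (M : closedSubspace E) z (x : M) :
  (forall y, csub_set M y -> dot (z - csub_val x) y = 0) -> projf M z = x.
Proof.
move=> xP; apply: val_inj; apply/eqP; rewrite -subr_eq0; apply/eqP.
set w := _ - _; have wM : csub_set M w by apply: csubB; exact: csub_in.
apply: nm_eq0; apply/eqP; rewrite -sqrf_eq0 -rdxx.
have {1}-> : w = (z - csub_val x) - (z - csub_val (projf M z)).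
  by rewrite opprB [RHS]addrC addrA subrK.
by rewrite /rd dotBl xP// projfP// subr0.
Qed.

Fact projf_linear E (M : closedSubspace E) : linear (projf M).
Proof.
move=> a x y; apply: projf_unique => z zM.
rewrite csub_valD csub_valZ opprD addrACA -scalerBr dotDl dotZl.
by rewrite !projfP// mulr0 addr0.
Qed.

Lemma nm_projf E (M : closedSubspace E) (z : E) :
  nm z ^+ 2 = nm (z - csub_val (projf M z)) ^+ 2 + nm (projf M z) ^+ 2.
Proof.
have p0 := rd_eq0 (projfP z (csub_in (projf M z))).
have := nmD_sqr (z - csub_val (projf M z)) (csub_val (projf M z)).
by rewrite subrK p0 mulr0 addr0.
Qed.

Fact projf_bounded E (M : closedSubspace E) z : nm (projf M z) <= 1 * nm z.
Proof.
rewrite mul1r -ler_sqr ?nnegrE ?nm_ge0// [leRHS](nm_projf M).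
by rewrite lerDr sqr_ge0.
Qed.

Definition projop E (M : closedSubspace E) : bop E M :=
  mkbop (@projf_linear E M) (@projf_bounded E M).

Lemma projopP E (M : closedSubspace E) z y :
  csub_set M y -> dot (z - csub_val (projop M z)) y = 0.
Proof. exact: projfP. Qed.

Lemma projop_id E (M : closedSubspace E) z :
  csub_set M z -> csub_val (projop M z) = z.
Proof.
move=> zM; rewrite -[RHS]/(csub_val (csub_of zM)); congr csub_val.
by apply: projf_unique => y yM; rewrite subrr dot0l.
Qed.

Lemma projop_eq0 E (M : closedSubspace E) z :
  (forall y, csub_set M y -> dot z y = 0) -> projop M z = 0.
Proof. by move=> zM; apply: projf_unique => y yM; rewrite subr0 zM. Qed.

Lemma perp_perp E (M : closedSubspace E) z :
  (forall y, (forall x, csub_set M x -> dot y x = 0) -> dot z y = 0) ->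
  csub_set M z.
Proof.
move=> zP; have zp : forall y, csub_set M y -> dot (z - csub_val (projop M z)) y = 0.
  by move=> y; exact: projopP.
suff -> : z = csub_val (projop M z) by exact: csub_in.
apply/eqP; rewrite -subr_eq0; apply/eqP/nm_eq0/eqP; rewrite -sqrf_eq0 -rdxx /rd.
rewrite dotBl zP// (dot_eq0C (zp _ (csub_in _))).
by rewrite subr0.
Qed.

(** The kernel [M] of the functional is a closed subspace. Off it, the component [w] of some [z]
    orthogonal to [M] spans the complement, and a multiple of [w] represents the functional. *)
Lemma riesz E F (T : bop E F) (y : F) :
  exists w : E, forall x, dot (T x) y = dot x w.
Proof.
have @M : closedSubspace E.
  apply: (@ClosedSubspace _ _ [set x | dot (T x) y = 0]) => /=.
  - by rewrite linear0 dot0l.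
  - by move=> a u v /= u0 v0; rewrite bopD bopZ dotDl dotZl u0 v0 mulr0 addr0.
  - apply: closed_nm => x /= xe.
    have C1 : 0 < opnorm T + 1 by rewrite ltr_wpDl// opnorm_ge0.
    have Txe (e : R) : 0 < e -> exists2 z, dot (T z) y = 0 & nm (T x - T z) < e.
      move=> e0; have [z zy xz] := xe _ (divr_gt0 e0 C1); exists z => //.
      move: xz; rewrite ltr_pdivlMr// -bopB; apply: le_lt_trans.
      apply: le_trans (opnormP _ _) _.
      by rewrite mulrC ler_wpM2l ?nm_ge0// lerDl.
    apply: dot_eq0; apply: rd_closed => e /Txe[z zy xz]; exists (T z) => //.
      exact: rd_eq0.
    by rewrite /rd dotZr zy mulr0.
have [[z z0]|] := pselect (exists z, dot (T z) y != 0); last first.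
  move=> nz; exists 0 => x; rewrite dot0r; apply: contrapT => /eqP xy.
  by apply: nz; exists x.
pose w := z - csub_val (projop M z).
have gw : dot (T w) y = dot (T z) y.
  by rewrite bopB dotBl (csub_in (projop M z) : dot (T _) y = 0) subr0.
have w0 : dot w w != 0.
  apply: contra_neq z0; rewrite -gw dotxx => /complexI/eqP.
  by rewrite sqrf_eq0 => /eqP/nm_eq0 ->; rewrite linear0 dot0l.
exists (conjc (dot (T w) y / dot w w) *: w) => x.
have xM : csub_set M (x - (dot (T x) y / dot (T w) y) *: w).
  by rewrite /= bopB bopZ dotBl dotZl divfK ?subrr// gw.
have := dot_eq0C (projopP z xM); rewrite -/w dotBl dotZl => /eqP.
rewrite subr_eq0 dotZr conjcK => /eqP ->.
by rewrite mulrACA mulVf// mulr1 mulrC divfK// gw.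
Qed.

Lemma adjointP E F (T : bop E F) x y : dot (T x) y = dot x (adjoint T y).
Proof.
suff [S SP] : exists S : bop F E, forall x y, dot (T x) y = dot x (S y).
  exact: (@xgetPex _ (0 : bop F E)
    [set S : bop F E | forall x y, dot (T x) y = dot x (S y)] (ex_intro _ S SP)).
have [S SP] := choice (riesz T).
have Sl : linear S.
  move=> a u v; apply: dot_ext => z.
  by rewrite -SP !dotDr !dotZr -!SP.
have SC z : nm (S z) <= opnorm T * nm z.
  have [->|Sz0] := eqVneq (S z) 0; first by rewrite nm0 mulr_ge0 ?nm_ge0// opnorm_ge0.
  rewrite -(ler_pM2l (nm_gt0 Sz0)) -expr2 -rdxx /rd -SP.
  apply: le_trans (rd_le _ _) _; rewrite mulrA (mulrC (nm (S z))).
  by rewrite ler_wpM2r ?nm_ge0// opnormP.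
by exists (mkbop Sl SC) => x' y'; exact: SP.
Qed.

Lemma adjointPr E F (T : bop E F) x y : dot (adjoint T x) y = dot x (T y).
Proof. by rewrite dotC -adjointP -dotC. Qed.

Lemma rd_adjoint E F (T : bop E F) x y : rd (T x) y = rd x (adjoint T y).
Proof. by rewrite /rd adjointP. Qed.

Lemma rd_adjointl E F (T : bop E F) x y : rd (adjoint T x) y = rd x (T y).
Proof. by rewrite /rd adjointPr. Qed.

(** The sesquilinear defect [g] vanishes on the diagonal because positive elements of [R[i]] are
    real. Polarizing with $x + y$ and then with $y$ replaced by $iy$ kills it everywhere; this is
    where complex scalars matter. *)
Lemma positive_selfadjoint E (P : bop E E) : positive_op P ->
  forall x y, dot (P x) y = dot x (P y).
Proof.
move=> P0.
pose g x y := dot (P x) y - dot x (P y).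
have gxx x : g x x = 0.
  apply/eqP; rewrite subr_eq0; apply/eqP; rewrite [RHS]dotC.
  by move: (P0 x); rewrite lecE; case: (dot _ _) => a b /= /andP[/eqP -> _]; rewrite oppr0.
have gD x y : g x y + g y x = 0.
  rewrite -[RHS](gxx (x + y)) /g !bopD !dotDl !dotDr.
  have := gxx x; have := gxx y; rewrite /g => /subr0_eq -> /subr0_eq ->.
  ring.
move=> x y; apply/eqP; rewrite -subr_eq0 -/(g x y); apply/eqP.
have := gD x y; have := gD x ('i *: y).
have -> : g x ('i *: y) = - 'i * g x y.
  rewrite /g bopZ !dotZr -mulrBr; congr (_ * _); apply/eqP.
  by rewrite eq_complex/= ?oppr0 !eqxx.
have -> : g ('i *: y) x = 'i * g y x.
  by rewrite /g bopZ !dotZl -mulrBr.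
move=> h1 h2.
have : 2 * 'i * g x y = 0 :> R[i].
  have -> : 2 * 'i * g x y = 'i * (g x y + g y x) - (- 'i * g x y + 'i * g y x) by ring.
  by rewrite h1 h2 mulr0 subr0.
move/eqP; rewrite !mulf_eq0 pnatr_eq0/= => /orP[|/eqP//].
by rewrite eq_complex/= oner_eq0 andbF.
Qed.

End Projection.

(** * Square roots of positive operators by a monotone iteration *)

Section SquareRoot.
Context {R : realType}.
Implicit Types E F : hilbertType R.

Lemma nm_cvg_le E (u : nat -> E) l (C : R) : u @ \oo --> l ->
  (forall n, nm (u n) <= C) -> nm l <= C.
Proof.
move=> /cvg_nm ul uC; apply/ler_addgt0Pr => e /ul[N /(_ N (leqnn N)) uN].
have := nm_leB l (u N) 0; rewrite !subr0 (nmB l) => h.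
by apply: le_trans h _; rewrite addrC lerD ?uC// ltW.
Qed.

Lemma rd_cvg0 E F (u : nat -> E) l (v : nat -> F) m x y :
  u @ \oo --> l -> v @ \oo --> m ->
  (forall n, rd (u n) x = rd (v n) y) -> rd l x = rd m y.
Proof.
move=> /cvg_nm ul /cvg_nm vm uv; apply/eqP; rewrite -subr_eq0 -normr_le0.
apply/ler_addgt0Pr => e e0; rewrite add0r.
have x1 : 0 < 2 * (nm x + 1) by rewrite mulr_gt0// ltr_wpDl// nm_ge0.
have y1 : 0 < 2 * (nm y + 1) by rewrite mulr_gt0// ltr_wpDl// nm_ge0.
have [N1 N1P] := ul _ (divr_gt0 e0 x1); have [N2 N2P] := vm _ (divr_gt0 e0 y1).
pose n := maxn N1 N2.
have := N1P n (leq_maxl _ _); have := N2P n (leq_maxr _ _).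
rewrite !ltr_pdivlMr// => vn un.
have := rd_abs (u n - l) x; have := rd_abs (v n - m) y.
rewrite !rdBl uv !ler_norml => /andP[a1 a2] /andP[b1 b2].
have := nm_ge0 (u n - l); have := nm_ge0 (v n - m).
by move=> *; apply/andP; split; nra.
Qed.

Lemma pointwise_lim E F (Y : nat -> bop E F) (C : R) :
  (forall n x, nm (Y n x) <= C * nm x) ->
  (forall x, exists l : F, (fun n => Y n x) @ \oo --> l) ->
  exists L : bop E F, forall x, (fun n => Y n x) @ \oo --> L x.
Proof.
move=> YC /choice[L LP].
have Ll : linear L.
  move=> a x y; apply: (@cvg_unique _ (@norm_hausdorff _ F) _ _ _ _ (LP _)).
  rewrite (_ : (fun n => Y n (a *: x + y)) = (fun n => a *: Y n x + Y n y)).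
    by apply: cvgD (LP y); apply: cvgZl_tmp; exact: LP.
  by apply/funext => n; rewrite bopD bopZ.
have LC x : nm (L x) <= C * nm x by apply: nm_cvg_le (LP x) _ => n; exact: YC.
by exists (mkbop Ll LC).
Qed.

Section Iteration.
Context {E : hilbertType R} (B : bop E E).
Hypothesis B1 : forall x, nm (B x) <= nm x.
Hypothesis Bsym : forall x y, rd (B x) y = rd x (B y).

(** A fixed point $Y = (Y^2 + B)/2$ satisfies $(1 - Y)^2 = 1 - B$, so that $1 - Y$ is a square root
    of $1 - B$. *)
Fixpoint sqrt_iter n : bop E E :=
  if n is m.+1 then (2^-1 : R)%:C *: (sqrt_iter m \oB sqrt_iter m + B) else 0.

(* The same iteration started from B = 1; it dominates the operator one. *)
Fixpoint sqrt_maj n : R := if n is m.+1 then 2^-1 * (sqrt_maj m ^+ 2 + 1) else 0.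

Lemma sqrt_majP n : 0 <= sqrt_maj n <= 1.
Proof. by elim: n => [|n /andP[IH0 IH1]] /=; apply/andP; split; nra. Qed.

Lemma sqrt_maj_incr : {homo sqrt_maj : m n / (m <= n)%N >-> m <= n}.
Proof.
apply: homo_leq => [x|y x z|n]; [exact: lexx|exact: le_trans|].
have /andP[n0 n1] := sqrt_majP n; rewrite /=; nra.
Qed.

Lemma sqrt_iterS n x : sqrt_iter n.+1 x =
  (2^-1 : R)%:C *: (sqrt_iter n (sqrt_iter n x) + B x).
Proof. by []. Qed.

Lemma sqrt_iter_le n x : nm (sqrt_iter n x) <= sqrt_maj n * nm x.
Proof.
elim: n x => [|n IH] x; first by rewrite /= nm0 mul0r.
rewrite sqrt_iterS nmZr gtr0_norm ?invr_gt0// -mulrA ler_pM2l ?invr_gt0//.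
apply: le_trans (nmD _ _) _; rewrite mulrDl mul1r lerD// /=.
apply: le_trans (IH _) _; rewrite expr2 -mulrA ler_wpM2l//.
by case/andP: (sqrt_majP n).
Qed.

Lemma sqrt_iter_le1 n x : nm (sqrt_iter n x) <= 1 * nm x.
Proof.
apply: le_trans (sqrt_iter_le _ _) _.
by rewrite ler_wpM2r ?nm_ge0//; case/andP: (sqrt_majP n).
Qed.

Lemma sqrt_iter_sym n x y : rd (sqrt_iter n x) y = rd x (sqrt_iter n y).
Proof.
elim: n x y => [|n IH] x y; first by rewrite /rd /= dot0l dot0r.
by rewrite !sqrt_iterS rdZl rdZr rdDl rdDr !IH Bsym.
Qed.

(* a^2 - b^2 = a (a - b) + (a - b) b needs no commutation. *)
Lemma sqrt_iter_step n x : nm (sqrt_iter n.+1 x - sqrt_iter n x) <=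
  (sqrt_maj n.+1 - sqrt_maj n) * nm x.
Proof.
elim: n x => [|n IH] x.
  change (nm ((2^-1 : R)%:C *: (0 + B x) - 0) <= (2^-1 * (0 ^+ 2 + 1) - 0) * nm x).
  rewrite add0r !subr0 expr0n /= add0r mulr1 nmZr gtr0_norm ?invr_gt0//.
  by rewrite ler_pM2l ?invr_gt0.
have -> : sqrt_iter n.+2 x - sqrt_iter n.+1 x = (2^-1 : R)%:C *:
   (sqrt_iter n.+1 (sqrt_iter n.+1 x - sqrt_iter n x) +
    (sqrt_iter n.+1 (sqrt_iter n x) - sqrt_iter n (sqrt_iter n x))).
  rewrite bopB addrA subrK.
  rewrite (sqrt_iterS n.+1) [X in _ - X]sqrt_iterS.
  by rewrite -scalerBr opprD addrACA subrr addr0.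
rewrite nmZr gtr0_norm ?invr_gt0//.
have -> : sqrt_maj n.+2 - sqrt_maj n.+1 =
   2^-1 * ((sqrt_maj n.+1 - sqrt_maj n) * (sqrt_maj n.+1 + sqrt_maj n)).
  have e m : sqrt_maj m.+1 = 2^-1 * (sqrt_maj m ^+ 2 + 1) by [].
  by rewrite (e n.+1) {2}(e n); ring.
rewrite -mulrA ler_pM2l ?invr_gt0// mulrDr mulrDl.
have s0 := sqrt_maj_incr (leqnSn n).
have /andP[s1 _] := sqrt_majP n.+1; have /andP[s2 _] := sqrt_majP n.
apply: le_trans (nmD _ _) (lerD _ _).
  apply: le_trans (sqrt_iter_le _ _) _.
  by rewrite [leRHS]mulrAC [leRHS]mulrC ler_wpM2l.
apply: le_trans (IH _) _; rewrite -mulrA ler_wpM2l ?subr_ge0//.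
exact: sqrt_iter_le.
Qed.

Lemma sqrt_iter_dist m n x : (m <= n)%N ->
  nm (sqrt_iter n x - sqrt_iter m x) <= (sqrt_maj n - sqrt_maj m) * nm x.
Proof.
move=> /subnK <-; elim: (n - m)%N => [|k IH]; first by rewrite !subrr nm0 mul0r.
rewrite addSn; apply: le_trans (nm_leB _ (sqrt_iter (k + m) x) _) _.
apply: le_trans (lerD (sqrt_iter_step _ _) IH) _.
by rewrite -mulrDl addrA subrK.
Qed.

(** The scalars [sqrt_maj] increase and are bounded by 1, hence vary little beyond some [N];
    [sqrt_iter_dist] transfers this to the operators. *)
Lemma sqrt_iter_cvg x : exists l : E, (fun n => sqrt_iter n x) @ \oo --> l.
Proof.
have Sup : has_sup (range sqrt_maj).
  split; first by exists (sqrt_maj 0), 0%N.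
  by exists 1 => _ [n _ <-]; case/andP: (sqrt_majP n).
apply: cauchy_nm => e e0.
have x1 : 0 < nm x + 1 by rewrite ltr_wpDl// nm_ge0.
have [_ [N _ <-] NP] := sup_adherent (divr_gt0 e0 x1) Sup.
have near m : (N <= m)%N -> 0 <= sqrt_maj m - sqrt_maj N < e / (nm x + 1).
  move=> /sqrt_maj_incr Nm; rewrite subr_ge0 Nm/= ltrBlDr addrC -ltrBlDr.
  by apply: le_lt_trans NP; rewrite lerD2r; apply: sup_upper_bound => //; exists m.
have dist m n : (N <= m <= n)%N -> nm (sqrt_iter n x - sqrt_iter m x) < e.
  move=> /andP[Nm mn]; apply: le_lt_trans (sqrt_iter_dist _ mn) _.
  have /andP[n0 n1] := near n (leq_trans Nm mn).
  have := sqrt_maj_incr Nm; move: n1; rewrite ltr_pdivlMr//.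
  have := nm_ge0 x; move: (nm x) (sqrt_maj _) (sqrt_maj m) (sqrt_maj n) n0 => *.
  nra.
exists N => m n Nm Nn; have [mn|/ltnW nm] := leqP m n.
  by rewrite nmB; apply: dist; rewrite Nm.
by apply: dist; rewrite Nn.
Qed.

Lemma sqrt_iter_lim : exists Y : bop E E,
  [/\ forall x, Y (Y x) + B x = (2 : R)%:C *: Y x,
      forall x, nm (Y x) <= nm x & forall x y, rd (Y x) y = rd x (Y y)].
Proof.
have [Y YP] := pointwise_lim sqrt_iter_le1 sqrt_iter_cvg.
have Y1 x : nm (Y x) <= nm x.
  by apply: nm_cvg_le (YP x) _ => n; rewrite -[leRHS]mul1r sqrt_iter_le1.
exists Y; split=> [x||x y] //; last first.
  rewrite (rdC x); apply: rd_cvg0 (YP x) (YP y) _ => n.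
  by rewrite sqrt_iter_sym rdC.
apply: (@cvg_unique _ (@norm_hausdorff _ E)
  ((fun n => (2 : R)%:C *: sqrt_iter n.+1 x) @ \oo)).
  rewrite (_ : (fun n => _) = (fun n => sqrt_iter n (sqrt_iter n x) + B x)); last first.
    by apply/funext => n; rewrite sqrt_iterS scalerA -rmorphM divff ?pnatr_eq0// scale1r.
  apply: cvgD; last exact: cvg_cst.
  apply: nm_cvg => e e0; have e20 : 0 < e / 2 by rewrite divr_gt0.
  have [N1 N1P] := cvg_nm (YP x) e20; have [N2 N2P] := cvg_nm (YP (Y x)) e20.
  exists (maxn N1 N2) => n; rewrite geq_max => /andP[/N1P n1 /N2P n2].
  apply: le_lt_trans (nm_leB _ (sqrt_iter n (Y x)) _) _.
  rewrite (splitr e) ltrD// -bopB; apply: le_lt_trans (sqrt_iter_le1 _ _) _.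
  by rewrite mul1r.
by apply: cvgZl_tmp; have := YP x; rewrite -cvg_shiftS.
Qed.

End Iteration.

(** Positivity in [R[i]] also demands a zero imaginary part; symmetry tested on $x$ and $ix$
    provides it. *)
Lemma positive_rd E (P : bop E E) : (forall x y, rd (P x) y = rd x (P y)) ->
  (forall x, 0 <= rd (P x) x) -> positive_op P.
Proof.
move=> Ps P0 x; rewrite lecE/= P0 andbT.
have := Ps x ('i *: x); rewrite /rd bopZ !dotZr [dot x (P x)]dotC.
by case: (dot _ _) => a b /= h; apply/eqP; lra.
Qed.

Lemma adjoint_le E F (T : bop E F) (C : R) : 0 <= C ->
  (forall x, nm (T x) <= C * nm x) -> forall y, nm (adjoint T y) <= C * nm y.
Proof.
move=> C0 TC y; have [->|a0] := eqVneq (adjoint T y) 0.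
  by rewrite nm0 mulr_ge0 ?nm_ge0.
rewrite -(ler_pM2l (nm_gt0 a0)) -expr2 -rdxx -rd_adjoint.
apply: le_trans (rd_le _ _) _; rewrite mulrCA mulrA ler_wpM2r ?nm_ge0//.
Qed.

Lemma absopP E F (T : bop E F) :
  positive_op (absop T) /\ absop T \oB absop T = adjoint T \oB T.
Proof.
suff [P PP] : exists P, positive_op P /\ P \oB P = adjoint T \oB T.
  exact: (@xgetPex _ (0 : bop E E)
    [set P | positive_op P /\ P \oB P = adjoint T \oB T] (ex_intro _ P PP)).
(* The scaling by [c], positive even for $T = 0$, makes $B = 1 - c^{-2}T^*T$ a contraction, since
   $|T^*Tx| \leq c|Tx|$. The root is then $c(1 - Y)$. *)
pose c := opnorm T + 1; have c0 : 0 < c by rewrite ltr_wpDl// opnorm_ge0.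
pose K := adjoint T \oB T.
have Krd x : rd (K x) x = nm (T x) ^+ 2 by rewrite rdC -rd_adjoint rdxx.
have Kc x : nm (T x) <= c * nm x.
  by apply: le_trans (opnormP _ _) _; rewrite ler_wpM2r ?nm_ge0// lerDl.
have KT x : nm (K x) <= c * nm (T x) by apply: adjoint_le => //; exact: ltW.
pose w := c ^- 2; have w0 : 0 < w by rewrite invr_gt0 exprn_gt0.
have wc : w * c ^+ 2 = 1 by rewrite mulVf// sqrf_eq0 gt_eqF.
pose B := idop E - (w%:C *: K).
have BE x : B x = x - w%:C *: K x by [].
have [||Y [YE Y1 Ysym]] := @sqrt_iter_lim E B.
- move=> x; rewrite -ler_sqr ?nnegrE ?nm_ge0// BE nmB_sqr.
  rewrite rdZr rdC Krd nmZr exprMn gtr0_norm//.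
  have : nm (K x) ^+ 2 <= c ^+ 2 * nm (T x) ^+ 2.
    by rewrite -exprMn ler_sqr ?nnegrE ?KT ?mulr_ge0 ?nm_ge0 ?(ltW c0).
  move: (nm (K x) ^+ 2) (nm x ^+ 2) => k n Kk.
  suff : w ^+ 2 * k <= w * nm (T x) ^+ 2.
    move=> h; have := mulr_ge0 (ltW w0) (sqr_ge0 (nm (T x))); lra.
  rewrite expr2 -mulrA ler_pM2l// -[leRHS]mul1r -wc -mulrA ler_pM2l//.
- move=> x y; rewrite !BE rdBl rdBr rdZl rdZr; congr (_ - _ * _).
  by rewrite /K /= rdC -rd_adjoint rdC rd_adjoint.
pose P := c%:C *: (idop E - Y).
have PE x : P x = c%:C *: (x - Y x) by [].
exists P; split.
  apply: positive_rd => [x y|x]; rewrite !PE !rdZl ?rdZr !rdBl ?rdBr ?Ysym//.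
  apply: mulr_ge0; rewrite ?(ltW c0)// subr_ge0 rdxx; apply: le_trans (rd_le _ _) _.
  by rewrite expr2 ler_wpM2l ?nm_ge0.
apply: bop_ext => x; change (P (P x) = K x); rewrite !PE bopZ bopB -scalerBr scalerA -rmorphM.
have -> : x - Y x - (Y x - Y (Y x)) = w%:C *: K x.
  apply/eqP; rewrite -subr_eq0; apply/eqP.
  have /eqP := YE x; rewrite BE rmorph_nat scaler_nat mulr2n -subr_eq0 => /eqP <-.
  by rewrite opprB opprD !addrA [RHS](ACl (2*4*1*5*3)%AC).
by rewrite scalerA -rmorphM -expr2 mulrC wc scale1r.
Qed.

End SquareRoot.

(** * Compact operators *)

Section Compactness.
Context {R : realType}.
Implicit Types E F : hilbertType R.

Definition tot_bounded E (A : set E) := forall e : R, 0 < e ->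
  exists s : seq E, forall x, A x -> exists2 y, y \in s & nm (x - y) < e.

Lemma precompact_tot_bounded E (A : set E) : precompact A -> tot_bounded A.
Proof.
rewrite precompactE compact_cover => Ac e e0.
have e0' : 0 < e%:C :> R[i] by rewrite (ltcR 0).
have [x _||D _ AD] := Ac E (closure A) (fun x => ball x e%:C).
- exact: ball_open.
- by move=> x xA; exists x => //; exact: ballxx.
exists (finmap.enum_fset D) => x Ax; have [y /= yD] := AD x (subset_closure Ax).
by rewrite -ball_normE/= nmE ltcR nmB; exists y.
Qed.

(** An ultrafilter that contains the closure of [A] contains one of the finitely many balls covering
    it at each scale, so it is Cauchy and completeness gives its limit. *)
Lemma tot_bounded_precompact E (A : set E) : tot_bounded A -> precompact A.
Proof.
move=> At; rewrite precompactE compact_ultra => F FU FA.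
have [l Fl] : exists l : E, F --> l.
  apply/cvg_ex/cauchy_cvgP/cauchy_ballP => _ /realC_gt0[e e0 ->].
  have e40 : 0 < e / 4 by rewrite divr_gt0.
  have [s sP] := At _ e40.
  have [y ys Fy] : exists2 y, y \in s & F [set x | nm (x - y) < e / 2].
    apply: contrapT => nF.
    have : F (closure A `&` [set x | forall y, y \in s -> e / 2 <= nm (x - y)]).
      apply: filterI => //; elim: s {sP} nF => [|y s IH] nF.
        by apply: filterS filterT => x _ y; rewrite in_nil.
      have {}IH : F [set x | forall y, y \in s -> e / 2 <= nm (x - y)].
        by apply: IH => -[z zs Fz]; apply: nF; exists z => //; rewrite inE zs orbT.
      have [Fy|Fy] := @in_ultra_setVsetC _ F [set x | nm (x - y) < e / 2] FU.
        by exfalso; apply: nF; exists y => //; rewrite mem_head.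
      apply: filterS (filterI Fy IH) => x [/= xy xs] z.
      by rewrite inE => /predU1P[->|/xs//]; rewrite leNgt; apply/negP.
    move=> /filter_ex[x [/closureP/(_ _ e40)[a /sP[y ys ay] xa]] /(_ y ys)].
    by have := nm_leB x a y; lra.
  exists ([set x | nm (x - y) < e / 2], [set x | nm (x - y) < e / 2]) => //=.
  move=> [x z] [/= xy zy]; rewrite -ball_normE/= nmE ltcR.
  by have := nm_leB x y z; rewrite (nmB y); lra.
exists l; split=> //.
by apply: (closed_cvg _ (@closed_closure _ A) _ _ Fl).
Qed.

Lemma tot_boundedS E (A B : set E) : A `<=` B -> tot_bounded B -> tot_bounded A.
Proof.
by move=> AB Bt e /Bt[s sP]; exists s => x /AB/sP.
Qed.

Lemma tot_boundedD E (A B : set E) : tot_bounded A -> tot_bounded B ->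
  tot_bounded [set x + y | x in A & y in B].
Proof.
move=> At Bt e e0; have e20 : 0 < e / 2 by rewrite divr_gt0.
have [s sP] := At _ e20; have [t tP] := Bt _ e20.
exists [seq x + y | x <- s, y <- t] => _ [x Ax [y By <-]].
have [a As xa] := sP x Ax; have [b Bs yb] := tP y By.
exists (a + b); first exact: allpairs_f.
rewrite opprD addrACA; apply: le_lt_trans (nmD _ _) _.
by rewrite (splitr e) ltrD.
Qed.

Lemma tot_bounded_image E F (T : bop E F) (A : set E) : tot_bounded A ->
  tot_bounded (T @` A).
Proof.
move=> At e e0; have C1 : 0 < opnorm T + 1 by rewrite ltr_wpDl// opnorm_ge0.
have [s sP] := At _ (divr_gt0 e0 C1); exists (map T s) => _ [x /sP[y ys xy] <-].
exists (T y); first exact: map_f.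
move: xy; rewrite ltr_pdivlMr// -bopB; apply: le_lt_trans.
apply: le_trans (opnormP _ _) _.
by rewrite mulrC ler_wpM2l ?nm_ge0// lerDl.
Qed.

Lemma tot_bounded_segment E (h : E) (C : R) :
  tot_bounded [set t%:C *: h | t in [set t : R | `|t| <= C]].
Proof.
move=> e e0; have h1 : 0 < nm h + 1 by rewrite ltr_wpDl// nm_ge0.
pose d := e / (nm h + 1); have d0 : 0 < d by rewrite divr_gt0.
pose p (k : nat) := (k%:R * d - C)%:C *: h.
pose s := [seq p k | k <- iota 0 (Num.trunc (2 * C / d)).+1].
exists s => _ [t /= tC <-].
have /andP[t1 t2] : - C <= t <= C by rewrite -ler_norml.
pose k := Num.trunc ((t + C) / d).
have tC0 : 0 <= (t + C) / d by apply: divr_ge0; [lra|exact: ltW].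
have /andP[k1 k2] := truncn_itv tC0.
exists (p k).
  apply: (@map_f nat E p); rewrite mem_iota/= ltnS; apply: le_truncn.
  by rewrite ler_pM2r ?invr_gt0//; lra.
rewrite /p -scalerBl -rmorphB nmZr.
have td : `|t - (k%:R * d - C)| <= d.
  move: k1 k2; rewrite ler_pdivlMr// ltr_pdivrMr// -/k -natr1 => k1 k2.
  by rewrite ler_norml; apply/andP; split; lra.
apply: (@le_lt_trans _ _ (d * nm h)); first by rewrite ler_wpM2r ?nm_ge0.
by rewrite /d mulrAC ltr_pdivrMr// ltr_pM2l// ltrDl.
Qed.

(** The image of the unit ball under a rank-one map. The coefficient is split into real and
    imaginary part, the latter being [rd x ('i *: g)]. *)
Lemma tot_bounded_coef E (g h : E) :
  tot_bounded [set dot x g *: h | x in [set x : E | nm x <= 1]].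
Proof.
apply: tot_boundedS (tot_boundedD (tot_bounded_segment h (nm g))
  (tot_bounded_segment ('i *: h) (nm g))) => _ [x /= x1 <-].
exists ((rd x g)%:C *: h).
  by exists (rd x g) => //=; apply: le_trans (rd_abs _ _) _; rewrite ler_piMl// nm_ge0.
exists ((rd x ('i *: g))%:C *: ('i *: h)).
  exists (rd x ('i *: g)) => //=; apply: le_trans (rd_abs _ _) _.
  rewrite nmZ (_ : complex.Re `|'i| = 1) ?mul1r ?ler_piMl ?nm_ge0//.
  by rewrite normc_def/= expr0n/= add0r expr1n sqrtr1.
rewrite scalerA -scalerDl; congr (_ *: _).
rewrite /rd dotZr; case: (dot x g) => a b /=.
by apply/eqP; rewrite eq_complex/=; apply/andP; split; apply/eqP; ring.
Qed.

(** The sum is a finite-rank map $Q$ with $x - Qx \perp s$. A new vector [f] either vanishes on the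
    whole complement of [s] already, or some [k] in this complement with [dot k f != 0] serves to
    correct the residue. *)
Lemma finite_codim E (s : seq E) : exists n (g h : nat -> E), forall x f,
  f \in s -> dot (x - \sum_(i < n) dot x (g i) *: h i) f = 0.
Proof.
elim: s => [|f s [n [g [h IH]]]].
  by exists 0%N, (fun=> 0), (fun=> 0) => x f; rewrite in_nil.
have [[k [ks kf]]|nk] :=
    pselect (exists k, (forall f, f \in s -> dot k f = 0) /\ dot k f != 0); last first.
  exists n, g, h => x f'; rewrite inE => /predU1P[->|]; last exact: IH.
  apply: contrapT => /eqP xf; apply: nk; exists (x - \sum_(i < n) dot x (g i) *: h i).
  by split=> // f''; exact: IH.
(* Chosen so that [dot x gn] is $\langle x - Qx, f\rangle / \langle k, f\rangle$, with $Q$ the map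
   built so far: subtracting this multiple of [k] removes the component along [f]. *)
pose gn := conjc ((dot k f)^-1) *: (f - \sum_(i < n) dot f (h i) *: g i).
exists n.+1, (fun i => if i == n then gn else g i), (fun i => if i == n then k else h i).
move=> x f'; rewrite big_ord_recr/= eqxx.
under eq_bigr do rewrite ltn_eqF//.
rewrite opprD addrA; set y := x - _; rewrite dotBl dotZl.
rewrite inE => /predU1P[->|f's]; last by rewrite ks// IH// mulr0 subr0.
rewrite /gn dotZr conjcK mulrAC mulVf// mul1r /y dotBl dotBr.
have -> : dot (\sum_(i < n) dot x (g i) *: h i) f = dot x (\sum_(i < n) dot f (h i) *: g i).
  rewrite dot_suml dot_sumr; apply: eq_bigr => i _.
  by rewrite dotZl dotZr -dotC mulrC.
by rewrite subrr.
Qed.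

(** Here infinite dimension enters: if only 0 were orthogonal to [s], the finite-rank map of
    [finite_codim] would be the identity, and the [h i] would span. *)
Lemma infinite_perp E (s : seq E) : infinite_dimensional E ->
  exists x, nm x = 1 /\ forall f, f \in s -> dot x f = 0.
Proof.
move=> Einf; have [n [g [h gh]]] := finite_codim s.
suff [y y0 ys] : exists2 y, y != 0 & forall f, f \in s -> dot y f = 0.
  exists ((nm y)^-1%:C *: y); split=> [|f /ys]; last by rewrite dotZl => ->; rewrite mulr0.
  by rewrite nmZr gtr0_norm ?invr_gt0 ?nm_gt0// mulVf// gt_eqF// nm_gt0.
apply: contrapT => ny; apply: Einf; exists (mkseq h n) => x.
exists (fun i => dot x (g i)); rewrite size_mkseq.
transitivity (\sum_(i < n) dot x (g i) *: h i); last first.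
  by apply: eq_bigr => i _; rewrite nth_mkseq.
apply/eqP; rewrite -subr_eq0; apply/negPn/negP => xn; apply: ny.
by exists (x - \sum_(i < n) dot x (g i) *: h i) => // f; exact: gh.
Qed.

End Compactness.

Section CompactOperators.
Context {R : realType}.
Implicit Types E F : hilbertType R.

(* K is compact iff for every e > 0 this holds for some finite list s. *)
Definition small_on_perp E F (K : bop E F) (e : R) (s : seq E) :=
  forall x, (forall f, f \in s -> dot x f = 0) -> nm (K x) <= e * nm x.

Lemma compact_ball E F (K : bop E F) : compact_op K ->
  tot_bounded (K @` [set x | nm x <= 1]).
Proof.
move=> /precompact_tot_bounded; apply: tot_boundedS => _ [x /= x1 <-].
by exists x => //=; rewrite nm_le1.
Qed.

(** The list is the image under [adjoint K] of an [e]-net of the image of the ball: then [K x] is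
    orthogonal to the net, and for the net point [f] nearest to it $|Kx|^2 = \langle Kx, Kx -
    f\rangle \leq e|Kx|$. *)
Lemma compact_small_on_perp E F (K : bop E F) : compact_op K ->
  forall e : R, 0 < e -> exists s, small_on_perp K e s.
Proof.
move=> /compact_ball Kt e e0; have [s sP] := Kt e e0.
exists (map (adjoint K) s) => x xs.
have [->|x0] := eqVneq x 0; first by rewrite linear0 !nm0 mulr0.
have n0 := nm_gt0 x0.
pose y := (nm x)^-1%:C *: x.
have y1 : nm y = 1 by rewrite nmZr gtr0_norm ?invr_gt0// mulVf// gt_eqF.
have -> : nm (K x) = nm (K y) * nm x.
  by rewrite bopZ nmZr gtr0_norm ?invr_gt0// mulrAC mulVf ?mul1r ?gt_eqF.
rewrite ler_wpM2r ?nm_ge0//.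
have [|f fs Kf] := sP (K y); first by exists y => //=; rewrite y1.
have Kyf : rd (K y) f = 0.
  by rewrite rd_adjoint rd_eq0// dotZl xs ?map_f// mulr0.
have := rd_le (K y) (K y - f); rewrite rdBr Kyf subr0 rdxx expr2.
have [->|Ky0] := eqVneq (K y) 0; first by rewrite nm0 => _; exact: ltW.
by rewrite ler_pM2l ?nm_gt0// => /le_trans; apply; exact: ltW.
Qed.

(** [r] is the projection that kills the complement [M] of [s]. As $x - Qx$ lies in [M], $r = rQr$,
    so [K \oB r] has totally bounded image of the ball, while $K(x - rx)$ is at most $e/2$ there. *)
Lemma small_on_perp_compact E F (K : bop E F) :
  (forall e : R, 0 < e -> exists s, small_on_perp K e s) -> compact_op K.
Proof.
move=> Ks; apply: tot_bounded_precompact => e e0.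
have e20 : 0 < e / 2 by rewrite divr_gt0.
have [s sP] := Ks _ e20; have [n [g [h gh]]] := finite_codim s.
pose M := perp [set f | f \in s].
pose r : bop E E := idop E - (inclop M \oB projop M).
have rE x : r x = x - csub_val (projop M x) by [].
pose Q x := \sum_(i < n) dot x (g i) *: h i.
have Qt : tot_bounded [set Q x | x in [set x | nm x <= 1]].
  rewrite /Q; elim: n {gh Q} => [|n IH].
    move=> e' e'0; exists [:: 0] => _ [x _ <-].
    by exists 0; rewrite ?mem_head// big_ord0 subrr nm0.
  apply: tot_boundedS (tot_boundedD IH (tot_bounded_coef (g n) (h n))).
  move=> _ [x /= x1 <-]; exists (\sum_(i < n) dot x (g i) *: h i); first by exists x.
  by exists (dot x (g n) *: h n); [exists x|rewrite big_ord_recr].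
have rQ x : r (Q (r x)) = r x.
  have rrx : r (r x) = r x.
    rewrite [in LHS]rE projop_eq0 ?subr0// => y yM.
    by rewrite rE projopP.
  rewrite -[RHS]rrx; apply/eqP; rewrite eq_sym -subr_eq0 -bopB rE subr_eq0.
  by rewrite projop_id// => f fs; exact: gh.
have r1 x : nm (r x) <= nm x.
  rewrite -ler_sqr ?nnegrE ?nm_ge0// [leRHS](nm_projf M) rE lerDl sqr_ge0//.
have [t tP] := tot_bounded_image (K \oB r) Qt e20.
exists t => _ [x /= x1 <-]; rewrite nm_le1 in x1.
have [|y ys xy] := tP (K (r x)).
  exists (Q (r x)); last exact: (congr1 K (rQ x)).
  by exists (r x) => //=; exact: le_trans (r1 x) x1.
exists y => //; apply: le_lt_trans (nm_leB _ (K (r x)) _) _.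
rewrite (splitr e) ler_ltD// -bopB.
have -> : x - r x = csub_val (projop M x) by rewrite rE opprB addrC subrK.
apply: le_trans (sP _ _) _; first by move=> f fs; exact: (csub_in (projop M x)).
rewrite -[leRHS]mulr1 ler_wpM2l ?(ltW e20)//.
by apply: le_trans x1; rewrite -[leRHS]mul1r; exact: projf_bounded.
Qed.

Lemma compact_op0 E F : compact_op (0 : bop E F).
Proof.
by apply: small_on_perp_compact => e e0; exists [::] => x _; rewrite nm0 mulr_ge0 ?nm_ge0 ?ltW.
Qed.

Lemma compact_opD E F (K L : bop E F) : compact_op K -> compact_op L ->
  compact_op (K + L).
Proof.
move=> /compact_small_on_perp Ks /compact_small_on_perp Ls.
apply: small_on_perp_compact => e e0; have e20 : 0 < e / 2 by rewrite divr_gt0.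
have [s sP] := Ks _ e20; have [t tP] := Ls _ e20; exists (s ++ t) => x xst.
apply: le_trans (nmD _ _) _; rewrite (splitr e) mulrDl lerD// (sP, tP)// => f fs;
  by apply: xst; rewrite mem_cat fs ?orbT.
Qed.

Lemma compact_opZ E F a (K : bop E F) : compact_op K -> compact_op (a *: K).
Proof.
move=> /compact_small_on_perp Ks; apply: small_on_perp_compact => e e0.
have a0 : 0 <= complex.Re `|a| by rewrite normc_def sqrtr_ge0.
have a1 : 0 < complex.Re `|a| + 1 by rewrite ltr_wpDl.
have [s sP] := Ks _ (divr_gt0 e0 a1); exists s => x xs.
rewrite bopZE nmZ; apply: le_trans (ler_wpM2l a0 (sP x xs)) _.
rewrite mulrA ler_wpM2r ?nm_ge0// mulrA ler_pdivrMr// mulrC ler_wpM2l ?(ltW e0)//.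
by rewrite lerDl.
Qed.

Lemma compact_cluster E F (K : bop E F) (u : nat -> E) : compact_op K ->
  (forall n, nm (u n) <= 1) ->
  exists y, forall e : R, 0 < e -> forall N, exists2 n, (N <= n)%N & nm (K (u n) - y) < e.
Proof.
rewrite /compact_op precompactE => Kc u1.
have [|y [_ yP]] := Kc (K \o u @ \oo) _.
  by exists 0%N => // n _ /=; apply: subset_closure; exists (u n) => //=; rewrite nm_le1.
exists y => e e0 N; have e0' : 0 < e%:C :> R[i] by rewrite (ltcR 0).
have := yP [set K (u n) | n in [set n | (N <= n)%N]] _ _ (nbhsx_ballx y _ e0').
case.
  by exists N => // n /= Nn; exists n.
by move=> _ [[n /= Nn <-]]; rewrite -ball_normE/= nmE ltcR nmB; exists n.
Qed.

Lemma compact_eigen E (K : bop E E) (k : R) (M : closedSubspace E) :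
  compact_op K -> k != 0 ->
  (forall e : R, 0 < e -> exists x,
     [/\ csub_set M x, nm x = 1 & nm (K x - k%:C *: x) <= e]) ->
  exists x, [/\ csub_set M x, nm x = 1 & K x = k%:C *: x].
Proof.
move=> Kc k0 KM.
have /choice[u uP] (n : nat) : exists x,
    [/\ csub_set M x, nm x = 1 & nm (K x - k%:C *: x) <= n.+1%:R^-1].
  by apply: KM; rewrite invr_gt0 ltr0n.
have [|y yP] := compact_cluster Kc (u := u).
  by move=> n; have [_ -> _] := uP n.
have kk : `|k| > 0 by rewrite normr_gt0.
(* $K u_n$ clusters at $y$ and $K u_n - k u_n$ tends to 0, so $u_n$ itself clusters at $y/k$. *)
pose x := k^-1%:C *: y.
have yE : y = k%:C *: x by rewrite scalerA -rmorphM divff// scale1r.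
have near (e : R) : 0 < e -> exists n, nm (u n - x) < e /\ nm (K (u n) - k%:C *: u n) < e.
  move=> e0; have [d [d0 de dk]] : exists d : R,
      [/\ 0 < d, d <= e / 2 & d <= `|k| * e / 2].
    exists (Num.min (e / 2) (`|k| * e / 2)); split.
    - by rewrite lt_min !divr_gt0// mulr_gt0.
    - by rewrite ge_min lexx.
    - by rewrite ge_min lexx orbT.
  have [N _ NP] := @near_infty_natSinv_lt R (PosNum d0).
  have [n /NP nd Ky] := yP d d0 N; exists n.
  have {}nd : n.+1%:R^-1 < d by exact: nd.
  clear NP.
  have [_ _ un] := uP n; have de' : d <= e by lra.
  split; last exact: le_lt_trans un (lt_le_trans nd de').
  have dk' : d + d <= `|k| * e by lra.
  rewrite -(ltr_pM2l kk) -nmZr scalerBr -yE.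
  apply: le_lt_trans (nm_leB _ (K (u n)) _) _; rewrite (nmB _ (K (u n))).
  exact: lt_le_trans (ltrD (le_lt_trans un nd) Ky) dk'.
exists x.
have xM : csub_set M x.
  have := @csub_set_closed _ _ M; rewrite closure_id => ->; apply/closureP => e.
  by move=> /near[n [ne _]]; exists (u n); [have [] := uP n|rewrite nmB].
split=> //.
  apply/eqP; rewrite -subr_eq0 -normr_le0; apply/ler_addgt0Pr => e /near[n [ne _]].
  have [_ n1 _] := uP n; rewrite add0r ler_norml.
  have := nm_leB (u n) x 0; have := nm_leB x (u n) 0.
  by rewrite !subr0 (nmB x) n1 => *; apply/andP; split; lra.
apply/eqP; rewrite -subr_eq0; apply/eqP/nm_lt_eq0 => e e0.
pose C := opnorm K + `|k| + 1.
have C0 : 0 < C by rewrite /C; have := opnorm_ge0 K; lra.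
have [n [n1 n2]] := near _ (divr_gt0 e0 C0).
have eC : e / C * C = e by rewrite divfK// gt_eqF.
have -> : K x - k%:C *: x = K (x - u n) + (K (u n) - k%:C *: u n) + k%:C *: (u n - x).
  by rewrite bopB scalerBr !addrA !subrK.
apply: le_lt_trans (nmD _ _) (le_lt_trans (lerD (nmD _ _) (lexx _)) _).
rewrite nmZr; apply: le_lt_trans (lerD (lerD (opnormP _ _) (lexx _)) (lexx _)) _.
rewrite (nmB x) -eC /C; have o0 := opnorm_ge0 K.
move: n1 n2; move: (e / C) (nm (u n - x)) (nm (K (u n) - _)) => d a b ad bd.
suff : opnorm K * a + b + `|k| * a < d * (opnorm K + `|k| + 1) by [].
have := ler_wpM2l o0 (ltW ad); have := ler_wpM2l (ltW kk) (ltW ad); lra.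
Qed.

(** In a finite net of mesh $d/2$ no ball holds two of the points [K (v i)]; hence [A] is contained
    in the image of the net under the choice [p] of an index for each centre. *)
Lemma compact_finite E F (K : bop E F) (I : choiceType) (A : set I) (v : I -> E) (d : R) :
  compact_op K -> 0 < d -> (forall i, A i -> nm (v i) <= 1) ->
  (forall i j, A i -> A j -> i != j -> d <= nm (K (v i) - K (v j))) ->
  finite_set A.
Proof.
move=> /compact_ball Kt d0 v1 vd.
have [->|/set0P[i0 Ai0]] := eqVneq A set0; first exact: finite_set0.
have d20 : 0 < d / 2 by rewrite divr_gt0.
have [s sP] := Kt _ d20.
have /choice[p pP] (y : F) : exists i, (exists2 j, A j & nm (K (v j) - y) < d / 2) ->
    A i /\ nm (K (v i) - y) < d / 2.
  have [[i Ai iy]|ni] := pselect (exists2 j, A j & nm (K (v j) - y) < d / 2).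
    by exists i.
  by exists i0 => /ni.
apply: (@sub_finite_set _ _ (p @` [set` s])); last exact/finite_image/finite_seq.
move=> i Ai; have [|y ys iy] := sP (K (v i)); first by exists (v i) => //=; exact: v1.
exists y => //; have [|Ap py] := pP y; first by exists i.
apply/eqP/negPn/negP => pi; have := vd _ _ Ap Ai pi.
by have := nm_leB (K (v (p y))) y (K (v i)); rewrite (nmB y); lra.
Qed.

End CompactOperators.

(** * Compact perturbations of a scalar *)

Section Spectral.
Context {R : realType} {E : hilbertType R}.
Implicit Types (P S : bop E E) (M : closedSubspace E).

Lemma selfadjoint_invertible S (c : R) : 0 < c ->
  (forall x y, dot (S x) y = dot x (S y)) ->
  (forall x, c * nm x <= nm (S x)) -> invertible_op S.
Proof.
move=> c0 Ssym Sc.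
have Sinj x y : S x = S y -> x = y.
  move=> /eqP; rewrite -subr_eq0 -bopB => /eqP Sxy.
  have := Sc (x - y); rewrite Sxy nm0 pmulr_rle0// => h.
  by apply/eqP; rewrite -subr_eq0; apply/eqP/nm_eq0/eqP; rewrite eq_le h nm_ge0.
have /choice[G GP] (z : E) : exists x, S x = z.
  have [x xP] := least_squares z c0 Sc; exists x.
  have h : S (z - S x) = S 0.
    by apply: dot_ext => y; rewrite linear0 dot0r dotC Ssym xP conjc0.
  by have /eqP := Sinj _ _ h; rewrite subr_eq0 => /eqP.
have Gl : linear G.
  by move=> a x y; apply: Sinj; rewrite GP bopD bopZ !GP.
have GC x : nm (G x) <= c^-1 * nm x.
  by rewrite mulrC ler_pdivlMr// mulrC -{2}(GP x).
exists (mkbop Gl GC); split; apply: bop_ext => x; last exact: GP.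
by apply: Sinj; exact: GP.
Qed.

Lemma null_spaceP P (a : R[i]) x :
  csub_set (null_space (P - a *: idop E)) x <-> P x = a *: x.
Proof.
split=> [/eqP|Px]; first by rewrite bopBE bopZE subr_eq0 => /eqP.
by apply/eqP; rewrite bopBE bopZE subr_eq0; apply/eqP.
Qed.

Section PositiveOperator.
Variables (P : bop E E) (lam : R).
Hypothesis P0 : positive_op P.
Hypothesis lam0 : 0 <= lam.
Hypothesis PK : compact_op (P - lam%:C *: idop E).

Let Psym := positive_selfadjoint P0.

Lemma pos_rd_sym x y : rd (P x) y = rd x (P y).
Proof. by rewrite /rd Psym. Qed.

Lemma pos_rd_ge0 x : 0 <= rd (P x) x.
Proof. by have := P0 x; rewrite lecE/= => /andP[]. Qed.

(** $P^2 - a^2 = (P + a)(P - a)$, and $P + a$ is bounded below by $a$ since $P \geq 0$. *)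
Lemma pos_shift_le (a : R) x : 0 <= a ->
  a * nm (P x - a%:C *: x) <= nm (P (P x) - (a ^+ 2)%:C *: x).
Proof.
move=> a0; set y := P x - _.
have -> : P (P x) - (a ^+ 2)%:C *: x = P y + a%:C *: y.
  by rewrite /y bopB bopZ scalerBr addrA subrK scalerA -rmorphM -expr2.
rewrite -ler_sqr ?nnegrE ?nm_ge0 ?mulr_ge0 ?nm_ge0// nmD_sqr rdZr nmZr.
rewrite ger0_norm// lerDr; apply: addr_ge0; first exact: sqr_ge0.
by apply: mulr_ge0 => //; apply: mulr_ge0 => //; exact: pos_rd_ge0.
Qed.

(** The square is expanded using $\langle P^2x, x\rangle = |Px|^2$. The bound shows that $x$ is
    nearly an eigenvector of $P^2$ as soon as $|Px|$ is close to $a|x|$. *)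
Lemma pos_defect (a : R) x : 0 <= a -> nm (P (P x)) <= a * nm (P x) ->
  nm (P (P x) - (a ^+ 2)%:C *: x) ^+ 2 <=
  a ^+ 2 * (a ^+ 2 * nm x ^+ 2 - nm (P x) ^+ 2).
Proof.
move=> a0 PPx; rewrite nmB_sqr rdZr pos_rd_sym rdxx nmZr exprMn -normrX.
rewrite !ger0_norm ?exprn_ge0//.
have : nm (P (P x)) ^+ 2 <= a ^+ 2 * nm (P x) ^+ 2.
  by rewrite -exprMn ler_sqr ?nnegrE ?mulr_ge0 ?nm_ge0.
move: (nm (P (P x)) ^+ 2) (nm (P x) ^+ 2) (nm x ^+ 2) => p q r.
move: (a ^+ 2) => b h.
suff -> : b * (b * r - q) = b * q - 2 * (b * q) + b ^+ 2 * r by rewrite !lerD2r.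
by ring.
Qed.

Lemma eigen_of_norming M (a : R) y :
  (forall x, csub_set M x -> csub_set M (P x)) -> 0 <= a ->
  (forall x, csub_set M x -> nm (P x) <= a * nm x) ->
  csub_set M y -> a * nm y <= nm (P y) -> P y = a%:C *: y.
Proof.
move=> PM a0 Ma yM ay; have Pya : nm (P y) = a * nm y.
  by apply/eqP; rewrite eq_le ay Ma.
have [aE|a_neq0] := eqVneq a 0.
  by rewrite aE scale0r; apply: nm_eq0; rewrite Pya aE mul0r.
have a_gt0 : 0 < a by rewrite lt_neqAle eq_sym a_neq0.
have := pos_defect a0 (Ma _ (PM _ yM)); rewrite Pya exprMn subrr mulr0 => h.
have {}h : nm (P (P y) - (a ^+ 2)%:C *: y) = 0.
  by apply/eqP; rewrite -sqrf_eq0 eq_le h sqr_ge0.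
apply/eqP; rewrite -subr_eq0; apply/eqP/nm_eq0/eqP; rewrite eq_le nm_ge0 andbT.
by rewrite -(pmulr_rle0 _ a_gt0) -h pos_shift_le.
Qed.

Lemma nm_normalize (x : E) : x != 0 -> nm ((nm x)^-1%:C *: x) = 1.
Proof.
by move=> x0; rewrite nmZr gtr0_norm ?invr_gt0 ?nm_gt0// mulVf ?gt_eqF ?nm_gt0.
Qed.

Lemma max_eigen M (a : R) : (forall x, csub_set M x -> csub_set M (P x)) ->
  lam <= a -> (forall x (b : R), csub_set M x -> a < b -> P x = b%:C *: x -> x = 0) ->
  forall x, csub_set M x -> nm (P x) <= a * nm x.
Proof.
move=> PM lama noeig x0 x0M; rewrite leNgt; apply/negP => x0a.
have x0n0 : x0 != 0.
  by apply: contraTneq x0a => ->; rewrite linear0 !nm0 mulr0 ltxx.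
pose A := [set nm (P x) | x in [set x | csub_set M x /\ nm x = 1]].
pose u := (nm x0)^-1%:C *: x0.
have uM : csub_set M u by exact: csubZ.
have u1 : nm u = 1 by exact: nm_normalize.
have A0 : has_sup A.
  split; first by exists (nm (P u)), u.
  by exists (opnorm P) => _ [x [_ x1] <-]; rewrite -[leRHS]mulr1 -x1 opnormP.
pose k := sup A.
have kub x : csub_set M x -> nm (P x) <= k * nm x.
  move=> xM; have [->|xn0] := eqVneq x 0; first by rewrite linear0 !nm0 mulr0.
  rewrite -ler_pdivrMr ?nm_gt0// mulrC -[X in X * _]gtr0_norm ?invr_gt0 ?nm_gt0//.
  rewrite -nmZr -bopZ; apply: sup_upper_bound => //.
  by exists ((nm x)^-1%:C *: x) => //; split; [exact: csubZ|exact: nm_normalize].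
have ak : a < k.
  by rewrite -(ltr_pM2r (nm_gt0 x0n0)); apply: lt_le_trans x0a (kub _ x0M).
have k0 : 0 < k by exact: le_lt_trans (le_trans lam0 lama) ak.
have [|e e0|x [xM x1 Kx]] := compact_eigen (k := k - lam) (M := M) PK.
- by rewrite subr_eq0 gt_eqF// (le_lt_trans lama).
(* For a unit $x$ the two lemmas give $|Px - kx|^2 \leq k^2 - |Px|^2 \leq 2k(k - |Px|)$, so being
   within $e^2/(2k)$ of the supremum suffices. *)
- have h0 : 0 < e ^+ 2 / (2 * k) by rewrite divr_gt0 ?exprn_gt0// mulr_gt0.
  have [_ [x [xM x1] <-] kx] := sup_adherent h0 A0.
  exists x; split=> //.
  have -> : (P - lam%:C *: idop E) x - (k - lam)%:C *: x = P x - k%:C *: x.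
    by rewrite bopBE bopZE/= rmorphB/= scalerBl opprB addrA subrK.
  have pk := kub _ xM; rewrite x1 mulr1 in pk.
  have := pos_defect (ltW k0) (kub _ (PM _ xM)).
  have := pos_shift_le x (ltW k0).
  rewrite -ler_sqr ?nnegrE ?mulr_ge0 ?nm_ge0 ?(ltW k0)// => /le_trans h /h.
  rewrite exprMn ler_pM2l ?exprn_gt0// x1 expr1n mulr1 => {}h.
  rewrite -ler_sqr ?nnegrE ?nm_ge0 ?(ltW e0)//; apply: le_trans h _.
  move: kx; rewrite -/k ltrBlDr -ltrBlDl ltr_pdivlMr ?mulr_gt0// => kx.
  by have := nm_ge0 (P x); nra.
have Px : P x = k%:C *: x.
  move: Kx; rewrite bopBE bopZE/= rmorphB/= scalerBl => /eqP.
  by rewrite subr_eq subrK => /eqP.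
by move: x1; rewrite (noeig _ _ xM ak Px) nm0 => /eqP; rewrite eq_sym oner_eq0.
Qed.

Lemma eigen_orthogonal (a b : R) x y : a != b ->
  P x = a%:C *: x -> P y = b%:C *: y -> dot x y = 0.
Proof.
move=> ab Px Py; have := Psym x y; rewrite Px Py dotZl dotZr conjc_real => /eqP.
rewrite -subr_eq0 -mulrBl mulf_eq0 -rmorphB => /orP[|/eqP//].
by rewrite -(rmorph0 (real_complex R)) (inj_eq (@complexI R)) subr_eq0 (negPf ab).
Qed.

(** If $P - a$ is not bounded below, its approximate null vectors yield an eigenvector by
    [compact_eigen], as $a - \lambda \neq 0$; if it is, self-adjointness makes it invertible. *)
Lemma spectrum_eigen (a : R) : a != lam -> spectrum P a%:C ->
  exists x, nm x = 1 /\ P x = a%:C *: x.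
Proof.
move=> alam Pa; apply: contrapT => noeig; apply: Pa.
pose top : closedSubspace E := perp set0.
have topE x : csub_set top x by move=> y [].
have [c c0 Pc] : exists2 c : R, 0 < c & forall x, nm x = 1 -> c <= nm (P x - a%:C *: x).
  apply: contrapT => nc; apply: noeig.
  have [|e e0|x [_ x1 Kx]] := compact_eigen (k := a - lam) (M := top) PK.
  - by rewrite subr_eq0.
  - apply: contrapT => ne; apply: nc; exists e => // x x1; rewrite leNgt.
    apply/negP => xe; apply: ne; exists x; split=> //; rewrite bopBE bopZE/=.
    by rewrite rmorphB/= scalerBl opprB addrA subrK ltW.
  exists x; split=> //; move: Kx; rewrite bopBE bopZE/= rmorphB/= scalerBl => /eqP.
  by rewrite subr_eq subrK => /eqP.
apply: (@selfadjoint_invertible _ c) => // [x y|x]; rewrite !bopBE !bopZE/=.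
  by rewrite dotBl dotBr dotZl dotZr conjc_real Psym.
have [->|x0] := eqVneq x 0; first by rewrite nm0 mulr0 nm_ge0.
have := Pc _ (nm_normalize x0).
rewrite bopZ scalerA mulrC -scalerA -scalerBr nmZr gtr0_norm ?invr_gt0 ?nm_gt0//.
by rewrite mulrC ler_pdivlMr ?nm_gt0.
Qed.

(** Unit eigenvectors for distinct eigenvalues are orthogonal, so their images under the compact $P
    - \lambda$ are at mutual distance at least $e$. *)
Lemma eigen_finite (e : R) : 0 < e ->
  finite_set [set a | lam + e <= a /\ exists x, nm x = 1 /\ P x = a%:C *: x].
Proof.
move=> e0.
have /choice[v vP] (a : R) : exists x, (exists x, nm x = 1 /\ P x = a%:C *: x) ->
    nm x = 1 /\ P x = a%:C *: x.
  have [[x xP]|na] := pselect (exists x, nm x = 1 /\ P x = a%:C *: x).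
    by exists x.
  by exists 0 => /na.
apply: (compact_finite (v := v) PK e0) => [a [_ /vP[-> _]]//|a b].
move=> [ae /vP[a1 Pa]] [be /vP[b1 Pb]] ab.
have KE c x : P x = c%:C *: x -> (P - lam%:C *: idop E) x = (c - lam)%:C *: x.
  by move=> Px; rewrite bopBE bopZE/= Px rmorphB/= scalerBl.
rewrite (KE a)// (KE b)// -ler_sqr ?nnegrE ?nm_ge0 ?(ltW e0)// nmB_sqr.
rewrite rdZl rdZr (rd_eq0 (eigen_orthogonal ab Pa Pb)) !mulr0 subr0.
rewrite !nmZr a1 b1 !mulr1 !real_normK ?num_real//.
by have : e ^+ 2 <= (a - lam) ^+ 2 + (b - lam) ^+ 2 by nra.
Qed.

End PositiveOperator.

Lemma eigen_spectrum P (a : R[i]) x : nm x = 1 -> P x = a *: x -> spectrum P a.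
Proof.
move=> x1 Px [S [/(congr1 (fun T : bop E E => T x)) SP _]].
have {}SP : S ((P - a *: idop E) x) = x by [].
move: SP; rewrite bopBE bopZE Px subrr linear0 => x0.
by move: x1; rewrite -x0 nm0 => /eqP; rewrite eq_sym oner_eq0.
Qed.

End Spectral.

(** An infinite [A] is a countable union of the finite sets above $l + 1/(n+1)$, hence in bijection
    with the naturals. The enumeration obtained follows no particular order. *)
Lemma enumeration (R : realType) (A : set R) (l : R) :
  (forall a, A a -> l < a) ->
  (forall e : R, 0 < e -> finite_set [set a | A a /\ l + e <= a]) ->
  exists (n : option nat) (alpha : nat -> R),
    set_inj (index_set n) alpha /\ alpha @` index_set n = A.
Proof.
move=> Al Afin.
have [Af|Ainf] := pselect (finite_set A).
  have [s us sA] : exists2 s : seq R, uniq s & [set` s] = A.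
    case/finite_fsetP: Af => X ->; exists (finmap.enum_fset X) => //.
    exact: finmap.fset_uniq.
  exists (Some (size s)), (fun i => nth 0 s i); split.
    by move=> i j; rewrite !inE => /= si sj /eqP; rewrite nth_uniq// => /eqP.
  rewrite -sA; apply/seteqP; split => [_ [i /= si <-]|x /= xs].
    by rewrite /= mem_nth.
  by exists (index x s); rewrite /= ?index_mem// nth_index.
have Ac : countable A.
  apply: (@sub_countable _ _ _
    (\bigcup_(n in [set: nat]) [set a | A a /\ l + n.+1%:R^-1 <= a])).
    apply: subset_card_le => a Aa; have /Al la := Aa.
    have := la; rewrite -subr_gt0 => la0.
    have [N _ /(_ N (leqnn N)) /= NP] := @near_infty_natSinv_lt R (PosNum la0).
    by exists N => //; split=> //; rewrite -lerBrDl ltW.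
  apply: bigcup_countable => // n _; apply: finite_set_countable; apply: Afin.
  by rewrite invr_gt0 ltr0n.
have := eq_card_nat Ac Ainf; rewrite card_eq_sym => /card_set_bijP[f fb].
exists None, f; split; first by have [_ + _] := fb.
by apply/seteqP; split => [_ [n _ <-]|a Aa]; have [f1 f2 f3] := fb; [exact: f1|exact: f3].
Qed.

(** * Limits of absolutely norm attaining operators *)

Section NormAttaining.
Context {R : realType} {H : hilbertType R}.
Implicit Types (S T : bop H H) (s : seq H).

Definition perps s (x : H) := forall f, f \in s -> dot x f = 0.

(* A form, stable under norm limits, of the essential spectrum of T^*T having at
   most one point. *)
Definition ess_dichotomy T := forall a b : R, a < b -> exists s,
  (forall u, perps s u -> nm u = 1 -> a < nm (T u) ^+ 2) \/
  (forall u, perps s u -> nm u = 1 -> nm (T u) ^+ 2 < b).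

Lemma perpsD s x y : perps s x -> perps s y -> perps s (x + y).
Proof. by move=> xs ys f fs; rewrite dotDl xs// ys// addr0. Qed.
Lemma perpsZ s a x : perps s x -> perps s (a *: x).
Proof. by move=> xs f fs; rewrite dotZl xs// mulr0. Qed.
Lemma perps_cat s t x : perps (s ++ t) x -> perps s x /\ perps t x.
Proof. by move=> st; split=> f fs; apply: st; rewrite mem_cat fs ?orbT. Qed.

(** The form $|Sx|^2 - t|x|^2$ is negative at [u] and positive at [v], so it vanishes at some $u +
    rv$; [r] is the explicit root of $dr^2 + 2hr + c$. This allows the norms along a sequence to be
    prescribed exactly. *)
Lemma intermediate_norm S s u v (t : R) : perps s u -> perps s v ->
  nm u = 1 -> nm v = 1 -> nm (S u) ^+ 2 < t -> t < nm (S v) ^+ 2 ->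
  exists z, [/\ perps s z, nm z = 1 & nm (S z) ^+ 2 = t].
Proof.
move=> us vs u1 v1 ut tv.
pose c := nm (S u) ^+ 2 - t; pose d := nm (S v) ^+ 2 - t.
pose h := rd (S u) (S v) - t * rd u v.
have c0 : c < 0 by rewrite subr_lt0.
have d0 : 0 < d by rewrite subr_gt0.
pose r := (Num.sqrt (h ^+ 2 - c * d) - h) / d.
have rP : d * r ^+ 2 + 2 * h * r + c = 0.
  have cd : 0 <= h ^+ 2 - c * d by have := sqr_ge0 h; nra.
  have dr : d * r = Num.sqrt (h ^+ 2 - c * d) - h by rewrite mulrC divfK// gt_eqF.
  apply/eqP; rewrite -(mulrI_eq0 _ (lregP (lt0r_neq0 d0))); apply/eqP.
  have -> : d * (d * r ^+ 2 + 2 * h * r + c) = (d * r) ^+ 2 + 2 * h * (d * r) + c * d by ring.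
  by rewrite dr; have := sqr_sqrtr cd; move: (Num.sqrt _) => w w2; rewrite sqrrB w2; ring.
pose w := u + r%:C *: v.
have w0 : w != 0.
  apply/eqP => w0; have uE : u = (- r)%:C *: v.
    by move/eqP: w0; rewrite addr_eq0 rmorphN scaleNr => /eqP.
  have : nm u = nm ((- r)%:C *: v) by rewrite -uE.
  rewrite nmZr u1 v1 mulr1 => r1.
  have : nm (S u) = nm (S v) by rewrite uE bopZ nmZr -r1 mul1r.
  by move=> Suv; move: ut tv; rewrite Suv => ut /(lt_trans ut); rewrite ltxx.
exists ((nm w)^-1%:C *: w); split.
- by apply: perpsZ; apply: perpsD => //; exact: perpsZ.
- exact: nm_normalize.
rewrite bopZ nmZr gtr0_norm ?invr_gt0 ?nm_gt0// exprMn exprVn.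
suff -> : nm (S w) ^+ 2 = t * nm w ^+ 2.
  by rewrite mulrC mulfK// sqrf_eq0 gt_eqF// nm_gt0.
rewrite /w bopD bopZ !nmD_sqr !rdZr !nmZr !exprMn real_normK ?num_real// u1 v1.
move: rP; rewrite /c /d /h; move: (rd u v) (rd (S u) (S v)) (nm (S u) ^+ 2) (nm (S v) ^+ 2).
move: (r) => r' p q k l rP; apply/eqP; rewrite -subr_eq0 -rP; apply/eqP; ring.
Qed.

(* Otherwise one finds an orthonormal sequence z_n, also orthogonal for
   <S x, S y>, with |S z_n|^2 strictly increasing; then S does not attain its
   norm on the closed span of the z_n, here the double orthogonal complement. *)
Lemma norm_attaining_dichotomy S :
  absolutely_norm_attaining H S -> ess_dichotomy S.
Proof.
move=> SAN a b ab; apply: contrapT => nab.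
have low s : exists u, [/\ perps s u, nm u = 1 & nm (S u) ^+ 2 <= a].
  apply: contrapT => nu; apply: nab; exists s; left=> u us u1; rewrite ltNge.
  by apply/negP => ua; apply: nu; exists u.
have high s : exists u, [/\ perps s u, nm u = 1 & b <= nm (S u) ^+ 2].
  apply: contrapT => nu; apply: nab; exists s; right=> u us u1; rewrite ltNge.
  by apply/negP => ua; apply: nu; exists u.
(* Strictly increasing in the open interval from [a] to [b]; with $n + 1$ in place of $n + 2$ the
   first value would be [a] itself. *)
pose t (n : nat) : R := b - (b - a) / n.+2%:R.
have ba : 0 < b - a by rewrite subr_gt0.
have tab n : a < t n /\ t n < b.
  have n2 : 1 < n.+2%:R :> R by rewrite ltr1n.
  have n0 : 0 < n.+2%:R :> R by rewrite ltr0n.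
  rewrite /t; split; last by rewrite gtrBl divr_gt0.
  by rewrite ltrBrDl -ltrBrDr ltr_pdivrMr// ltr_pMr.
have tS n : t n < t n.+1.
  by rewrite /t ltrD2l ltrN2 ltr_pM2l// ltf_pV2 ?posrE ?ltr0n// ltr_nat.
pose Q := adjoint S \oB S.
have Qrd x y : dot x (Q y) = dot (S x) (S y) by rewrite adjointP.
have /choice[f fP] s : exists z, [/\ perps (s ++ map Q s) z, nm z = 1 &
    nm (S z) ^+ 2 = t (size s)].
  have [u [us u1 ua]] := low (s ++ map Q s).
  have [v [vs v1 vb]] := high (s ++ map Q s).
  have [t1 t2] := tab (size s).
  apply: intermediate_norm us vs u1 v1 _ _; first exact: le_lt_trans ua t1.
  exact: lt_le_trans t2 vb.
pose zs := fix zs n := if n is m.+1 then rcons (zs m) (f (zs m)) else [::].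
pose z n := f (zs n).
have zs_size n : size (zs n) = n by elim: n => //= n IH; rewrite size_rcons IH.
have zs_in m n : (m < n)%N -> z m \in zs n.
  elim: n => // n IH; rewrite ltnS leq_eqVlt => /predU1P[->|/IH].
    by rewrite /= mem_rcons mem_head.
  by rewrite /= mem_rcons inE => ->; rewrite orbT.
have z1 n : nm (z n) = 1 by case: (fP (zs n)).
have zt n : nm (S (z n)) ^+ 2 = t n by case: (fP (zs n)); rewrite zs_size.
have zz m n : m <> n -> dot (z m) (z n) = 0.
  have lt i j : (i < j)%N -> dot (z j) (z i) = 0.
    by move=> ij; have [/perps_cat[h _] _ _] := fP (zs j); apply/h/zs_in.
  by move=> /eqP; rewrite neq_ltn => /orP[/lt/dot_eq0C|/lt].
have zQz m n : m <> n -> dot (z m) (Q (z n)) = 0.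
  have lt i j : (i < j)%N -> dot (S (z j)) (S (z i)) = 0.
    move=> ij; have [/perps_cat[_ h] _ _] := fP (zs j); rewrite -Qrd.
    by apply/h/map_f/zs_in.
  by rewrite Qrd => /eqP; rewrite neq_ltn => /orP[/lt/dot_eq0C|/lt].
pose M := [set y | forall n, dot y (z n) = 0].
pose L := perp M.
have zL n : csub_set L (z n) by move=> y yM; apply/dot_eq0C/yM.
have [|x x1 xS] := SAN L.
  exists (csub_of (zL 0%N)); apply/eqP => /(congr1 csub_val) /= z0.
  by have := z1 0%N; rewrite z0 nm0 => /eqP; rewrite eq_sym oner_eq0.
set c := opnorm (S \oB inclop L).
have {}x1 : nm (csub_val x) = 1 by rewrite -csub_nmE /nm x1.
have {}xS : nm (S (csub_val x)) = c by rewrite /nm xS bop_normE.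
have Sc y : csub_set L y -> nm (S y) <= c * nm y.
  by move=> yL; exact: opnormP (S \oB inclop L) (csub_of yL).
have c0 : 0 <= c by exact: opnorm_ge0.
have xL := csub_in x; move: (csub_val x) x1 xS xL => {}x x1 xS xL.
have tc n : t n < c ^+ 2.
  apply: lt_le_trans (tS n) _; rewrite -zt ler_sqr ?nnegrE ?nm_ge0//.
  by have := Sc _ (zL n.+1); rewrite z1 mulr1.
(* The form $c^2|y|^2 - |Sy|^2$ is nonnegative on [L] and zero at [x], so its derivative at [x]
   vanishes along [L]. *)
have crit y : csub_set L y -> rd (S x) (S y) = c ^+ 2 * rd x y.
  move=> yL; apply/eqP; rewrite -subr_eq0; apply/eqP.
  apply: (@quad_lin_eq0 _ (c ^+ 2 * nm y ^+ 2 - nm (S y) ^+ 2)).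
    by rewrite subr_ge0 -exprMn ler_sqr ?nnegrE ?Sc ?mulr_ge0 ?nm_ge0.
  move=> r; have := Sc _ (csubD xL (csubZ (r%:C) yL)).
  rewrite -ler_sqr ?nnegrE ?mulr_ge0 ?nm_ge0// exprMn bopD bopZ !nmD_sqr.
  rewrite !rdZr !nmZr !exprMn real_normK ?num_real// xS x1.
  by move: (c ^+ 2) (nm y ^+ 2) (nm (S y) ^+ 2) => *; lra.
have xz n : dot x (z n) = 0.
  (* $Qz_n - t_n z_n$ is orthogonal to every $z_m$, so it lies in [M], to which [x] is orthogonal.
     Against [crit] this leaves $(t_n - c^2)$ times the product of $x$ with $z_n$ equal to 0, and
     $t_n < c^2$. *)
  have xQ : dot x (Q (z n)) = (t n)%:C * dot x (z n).
    have : dot x (Q (z n) - (t n)%:C *: z n) = 0.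
      apply: xL => m; rewrite dotBl dotZl.
      have [->|/eqP mn] := eqVneq m n.
        by rewrite (dotC (Q _)) Qrd !dotxx zt z1 conjc_real expr1n mulr1 subrr.
      by rewrite (dot_eq0C (zQz _ _ mn)) (dot_eq0C (zz _ _ mn)) mulr0 subr0.
    by rewrite dotBr dotZr conjc_real => /eqP; rewrite subr_eq0 => /eqP.
  have rz w : rd x (w *: z n) = 0.
    have := crit _ (csubZ w (zL n)).
    rewrite bopZ {1}/rd dotZr -Qrd xQ mulrCA -dotZr.
    have -> : complex.Re ((t n)%:C * dot x (w *: z n)) = t n * rd x (w *: z n).
      by rewrite /rd; case: (dot _ _) => p q /=; rewrite mul0r subr0.
    move=> /eqP; rewrite -subr_eq0 -mulrBl mulf_eq0 subr_eq0 lt_eqF ?tc//=.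
    by move/eqP.
  by apply: dot_eq0 (rz 'i); have := rz 1; rewrite scale1r.
(* By [xz] the vector [x] belongs to [M], and as an element of [L] it is orthogonal to [M]. *)
have : dot x x = 0 by apply: xL.
by rewrite dotxx x1 expr1n => /complexI/eqP; rewrite oner_eq0.
Qed.

Lemma closure_dichotomy T :
  closure (absolutely_norm_attaining H) T -> ess_dichotomy T.
Proof.
move=> Tcl a b ab.
pose d := (b - a) / 4; have d0 : 0 < d by rewrite divr_gt0// subr_gt0.
pose N := opnorm T; have N0 : 0 <= N by exact: opnorm_ge0.
(* For a unit $u$ and $|T - S| < e \leq 1$ one has $|Tu| + |Su| \leq 2N + 1$, so the squares differ
   by at most $e(2N + 1)$. *)
have [e [e0 e1 ed]] : exists e : R, [/\ 0 < e, e <= 1 & e * (2 * N + 1) <= d].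
  have N1 : 0 < 2 * N + 1 by lra.
  exists (Num.min 1 (d / (2 * N + 1))); split.
  - by rewrite lt_min ltr01 divr_gt0.
  - by rewrite ge_min lexx.
  - by rewrite -ler_pdivlMr// ge_min lexx orbT.
have e0' : 0 < e%:C :> R[i] by rewrite (ltcR 0).
have [S [SAN]] := Tcl _ (nbhsx_ballx T _ e0').
rewrite -ball_normE/= bop_normE ltcR => TS.
have [|s sP] := norm_attaining_dichotomy SAN (a := a + d) (b := b - d).
  by rewrite /d; lra.
have near u : nm u = 1 ->
    nm (T u) ^+ 2 - nm (S u) ^+ 2 <= d /\ nm (S u) ^+ 2 - nm (T u) ^+ 2 <= d.
  move=> u1; have Tu : nm (T u) <= N by rewrite -[leRHS]mulr1 -u1 opnormP.
  have TSu : nm (T u - S u) <= e.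
    by apply: le_trans (opnormP (T - S) u) _; rewrite u1 mulr1 ltW.
  have := nm_leB (T u) (S u) 0; have := nm_leB (S u) (T u) 0.
  rewrite !subr0 (nmB (S u)).
  have := nm_ge0 (T u); have := nm_ge0 (S u).
  move: (nm (T u)) (nm (S u)) (nm (T u - S u)) Tu TSu => p r g pN ge r0 p0 h1 h2.
  split; apply: le_trans ed; nra.
exists s; case: sP => sP; [left|right] => u us u1; have := sP u us u1;
  by have [] := near u u1; lra.
Qed.

(** [mu] is the supremum of the lower bounds of $|Tu|^2$ over unit vectors orthogonal to finite
    lists; infinite dimension bounds these by $|T|^2$. In the dichotomy for $\mu + e/2 < \mu + e$
    the first alternative contradicts the supremum, and the second is the upper bound sought. *)
Lemma dichotomy_scalar T : infinite_dimensional H -> ess_dichotomy T ->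
  exists2 mu : R, 0 <= mu & forall e : R, 0 < e -> exists s, forall u, perps s u ->
    `|nm (T u) ^+ 2 - mu * nm u ^+ 2| <= e * nm u ^+ 2.
Proof.
move=> Hinf TD.
pose A := [set a : R | exists s, forall u, perps s u -> nm u = 1 -> a < nm (T u) ^+ 2].
have negA a : a < 0 -> A a.
  by move=> a0; exists [::] => u _ _; apply: lt_le_trans a0 (sqr_ge0 _).
have A0 : has_sup A.
  split; first by exists (- 1); apply: negA; rewrite ltrN10.
  exists (opnorm T ^+ 2) => a [s sP]; have [x [x1 xs]] := infinite_perp s Hinf.
  apply: le_trans (ltW (sP x xs x1)) _.
  by rewrite ler_sqr ?nnegrE ?nm_ge0 ?opnorm_ge0// -[leRHS]mulr1 -x1 opnormP.
pose c := sup A.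
have cub a : A a -> a <= c by exact: sup_upper_bound.
exists c.
  apply/ler_addgt0Pr => e e0; rewrite -lerBlDr sub0r; apply: cub; apply: negA.
  by rewrite oppr_lt0.
move=> e e0; have [a [s sP] ca] := sup_adherent e0 A0.
have [|t tP] := TD (c + e / 2) (c + e).
  by lra.
have {}tP u : perps t u -> nm u = 1 -> nm (T u) ^+ 2 < c + e.
  case: tP => [tP|]; last exact.
  have /cub : A (c + e / 2) by exists t.
  by lra.
exists (s ++ t) => u /perps_cat[us ut].
have [->|u0] := eqVneq u 0.
  by rewrite linear0 !nm0 expr0n !mulr0 subr0 normr0.
have v1 := nm_normalize u0.
have := sP _ (perpsZ _ us) v1; have := tP _ (perpsZ _ ut) v1.
rewrite bopZ nmZr gtr0_norm ?invr_gt0 ?nm_gt0// exprMn exprVn => h1 h2.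
have n0 : 0 < nm u ^+ 2 by rewrite exprn_gt0// nm_gt0.
have -> : nm (T u) ^+ 2 - c * nm u ^+ 2 =
    ((nm u ^+ 2)^-1 * nm (T u) ^+ 2 - c) * nm u ^+ 2.
  by rewrite mulrBl mulrAC mulVf ?mul1r// gt_eqF.
rewrite normrM (gtr0_norm n0) ler_pM2r// ler_norml.
by apply/andP; split; move: ca; rewrite -/c; lra.
Qed.

(** Polarization with [y], which is [K x] rescaled to the length of [x]: the form at $x + y$ minus
    that at $x - y$ is $4\langle Kx, y\rangle = 4|x||Kx|$, and it is at most $4e|x|^2$. Adding
    [map K s] to the list keeps [K x] orthogonal to [s]. *)
Lemma small_form_small_on_perp (K : bop H H) (e : R) s : 0 <= e ->
  (forall x y, dot (K x) y = dot x (K y)) ->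
  (forall x, perps s x -> `|rd (K x) x| <= e * nm x ^+ 2) ->
  small_on_perp K e (s ++ map K s).
Proof.
move=> e0 Ksym Ks x /perps_cat[xs xKs].
have Kxs : perps s (K x) by move=> f fs; rewrite Ksym xKs// map_f.
have [->|Kx0] := eqVneq (K x) 0; first by rewrite nm0 mulr_ge0 ?nm_ge0.
have x0 : 0 < nm x.
  by apply: nm_gt0; apply: contraNneq Kx0 => ->; rewrite linear0.
pose y := (nm x / nm (K x))%:C *: K x.
have ys : perps s y by exact: perpsZ.
have yn : nm y = nm x.
  rewrite nmZr gtr0_norm; first by rewrite divfK// gt_eqF// nm_gt0.
  by apply: divr_gt0 => //; exact: nm_gt0.
have Kxy : rd (K x) y = nm x * nm (K x).
  by rewrite rdZr rdxx expr2 mulrA divfK// gt_eqF ?nm_gt0.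
have xy1 := Ks _ (perpsD xs ys).
have xy2 := Ks _ (perpsD xs (perpsZ (- 1) ys)).
move: xy1 xy2; rewrite scaleN1r nmD_sqr nmB_sqr yn bopB bopD.
rewrite !rdBl !rdBr !rdDl !rdDr.
have -> : rd (K y) x = nm x * nm (K x) by rewrite /rd Ksym -/(rd _ _) rdC Kxy.
rewrite Kxy !ler_norml => /andP[h1 h2] /andP[h3 h4].
rewrite -(ler_pM2l x0).
suff : nm x * nm (K x) <= nm x * (e * nm x) by [].
by nra.
Qed.

Lemma absop_compact T : infinite_dimensional H ->
  closure (absolutely_norm_attaining H) T ->
  exists2 lam : R, 0 <= lam & compact_op (absop T - lam%:C *: idop H).
Proof.
move=> Hinf /closure_dichotomy/(dichotomy_scalar Hinf)[mu mu0 muP].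
have [P0 PP] := absopP T; move: (absop T) P0 PP => P P0 PP.
have {}PP x : P (P x) = adjoint T (T x) := congr1 (fun S : bop H H => S x) PP.
have Psym := positive_selfadjoint P0.
pose lam := Num.sqrt mu; have lam0 : 0 <= lam by exact: sqrtr_ge0.
have lam2 : lam ^+ 2 = mu by rewrite sqr_sqrtr.
exists lam => //.
pose K := (P \oB P) - mu%:C *: idop H.
have KE x : K x = P (P x) - mu%:C *: x by [].
have Kcpt (e : R) : 0 < e -> exists s, small_on_perp K e s.
  move=> e0; have [s sP] := muP e e0; exists (s ++ map K s).
  apply: small_form_small_on_perp => [|x y|x /sP]; first exact: ltW.
    by rewrite !KE dotBl dotBr dotZl dotZr conjc_real !Psym.
  by rewrite KE rdBl rdZl PP rdC -rd_adjoint !rdxx.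
apply: small_on_perp_compact => e e0.
(* From $P^2 - \lambda^2$ to $P - \lambda$: for $\lambda > 0$ the factor $P + \lambda$ is divided
   out; for $\lambda = 0$ one uses $|Px|^2 \leq |P^2x||x|$, whence the tolerance $e^2$. *)
have [l0|] := eqVneq lam 0.
  have [s sP] := Kcpt _ (exprn_gt0 2 e0); exists s => x /sP.
  rewrite bopBE bopZE l0 scale0r subr0 KE -lam2 l0 expr0n/= scale0r subr0 => h.
  rewrite -ler_sqr ?nnegrE ?mulr_ge0 ?nm_ge0 ?(ltW e0)// -rdxx /rd -Psym.
  apply: le_trans (rd_le _ _) _; rewrite exprMn [in leRHS]expr2 mulrA.
  by rewrite ler_wpM2r ?nm_ge0.
move=> l0; have {}l0 : 0 < lam by rewrite lt_neqAle eq_sym l0.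
have [s sP] := Kcpt _ (mulr_gt0 l0 e0); exists s => x /sP h.
rewrite bopBE bopZE -(ler_pM2l l0) mulrA; apply: le_trans h.
by rewrite KE -lam2; apply: (pos_shift_le P0).
Qed.

End NormAttaining.

(** * Block form of a *-paranormal operator *)

Lemma finite_set_max (R : realType) (A : set R) : finite_set A -> A !=set0 ->
  exists2 m, A m & forall a, A a -> a <= m.
Proof.
move=> /finite_seqP[s ->]; elim: s => [|b s IH] [a /=]; first by rewrite in_nil.
move=> _; have [s0|] := pselect ([set` s] !=set0); last first.
  move=> ns; exists b; rewrite /= ?mem_head// => c; rewrite inE => /predU1P[->//|cs].
  by exfalso; apply: ns; exists c.
have [m ms mP] := IH s0; exists (Num.max b m).
  by rewrite /= inE; case: leP => _; rewrite ?eqxx// (ms : m \in s) orbT.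
by move=> c /=; rewrite inE le_max => /predU1P[->|/mP ->]; rewrite ?lexx// orbT.
Qed.

(** * Essential spectrum of a compact perturbation of a scalar *)

Section EssentialSpectrum.
Context {R : realType} {H : hilbertType R}.
Implicit Types P S K : bop H H.

Lemma calkin_eqP P S : compact_op (P - S) -> calkin P = calkin S.
Proof.
move=> PS; apply/seteqP; split=> Q QP; rewrite /calkin /=.
  by rewrite -(subrKA P Q); exact: compact_opD.
rewrite -(subrKA S Q); apply: compact_opD => //.
have -> : S - P = (-1 : R[i]) *: (P - S) by rewrite scaleN1r opprB.
exact: compact_opZ.
Qed.

(** For $z \neq a$ the scalar $(a - z)^{-1}$ inverts $P - z$ modulo compacts. For $z = a$, an
    inverse $S$ modulo compacts would make both $P - a$ and $1 - S(P - a)$ small on some unit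
    vector, which gives $1 \leq 1/4 + 1/4$. *)
Lemma essential_spectrum_scalar P (a : R[i]) : infinite_dimensional H ->
  compact_op (P - a *: idop H) -> essential_spectrum P = [set a].
Proof.
move=> Hinf PK; apply/seteqP; split=> [z zP|_ ->].
  apply: contrapT => za; apply: zP.
  have az : a - z != 0 by rewrite subr_eq0; apply/eqP => /esym.
  pose S : bop H H := (a - z)^-1 *: idop H.
  have main x : (a - z)^-1 *: (P x - z *: x) - x = (a - z)^-1 *: (P x - a *: x).
    rewrite -[X in _ - X = _]scale1r -(mulVf az) -scalerA -scalerBr scalerBl; congr (_ *: _).
    by rewrite opprB addrA subrK.
  have Kc := compact_opZ (a - z)^-1 PK.
  exists S; split; apply: calkin_eqP.
    rewrite (_ : _ - _ = (a - z)^-1 *: (P - a *: idop H))//.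
    by apply: bop_ext => x; exact: main.
  rewrite (_ : _ - _ = (a - z)^-1 *: (P - a *: idop H))//.
  apply: bop_ext => x.
  change (P ((a - z)^-1 *: x) - z *: ((a - z)^-1 *: x) - x =
    (a - z)^-1 *: (P x - a *: x)).
  by rewrite -main bopZ scalerBr !scalerA (mulrC z).
move=> [S [SP _]].
have Ic : compact_op (idop H - S \oB (P - a *: idop H)).
  have : calkin (idop H) (idop H).
    by rewrite /calkin /= subrr; exact: compact_op0.
  by rewrite -SP.
have Pc := compact_small_on_perp PK.
have h0 : 0 < (opnorm S + 1)^-1 / 4 :> R.
  by rewrite divr_gt0// invr_gt0 ltr_wpDl// opnorm_ge0.
have [s sP] := Pc _ h0; have q0 : 0 < 1 / 4 :> R by rewrite divr_gt0.
have [t tP] := compact_small_on_perp Ic q0.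
have [x [x1 xst]] := infinite_perp (s ++ t) Hinf.
have := sP x; have := tP x; rewrite x1 !mulr1 => tx sx.
have {}tx : nm (x - S ((P - a *: idop H) x)) <= 1 / 4.
  by apply: tx => f ft; apply: xst; rewrite mem_cat ft orbT.
have {}sx : nm ((P - a *: idop H) x) <= (opnorm S + 1)^-1 / 4.
  by apply: sx => f fs; apply: xst; rewrite mem_cat fs.
have := nm_leB x (S ((P - a *: idop H) x)) 0; rewrite !subr0 x1.
have Sx : nm (S ((P - a *: idop H) x)) <= 1 / 4.
  apply: le_trans (opnormP _ _) _.
  apply: le_trans (ler_wpM2l (opnorm_ge0 S) sx) _.
  rewrite mulrA ler_pM2r ?invr_gt0// ler_pdivrMr ?ltr_wpDl ?opnorm_ge0//.
  by rewrite mul1r lerDl.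
by move: tx Sx; lra.
Qed.

End EssentialSpectrum.

(** * Eigenspaces of |T| at and above lambda *)

Section StarParanormal.
Context {R : realType} {H : hilbertType R}.
Variables (T : bop H H) (lam : R).
Local Notation P := (absop T).
Hypothesis Tpara : star_paranormal T.
Hypothesis lam0 : 0 <= lam.
Hypothesis PK : compact_op (P - lam%:C *: idop H).

Let P0 : positive_op P := (absopP T).1.
Let Psym := positive_selfadjoint P0.

Lemma adjoint_absop x : adjoint T (T x) = P (P x).
Proof. exact: esym (congr1 (fun S : bop H H => S x) (absopP T).2). Qed.

Lemma dot_absop x y : dot (T x) (T y) = dot (P x) (P y).
Proof. by rewrite adjointP adjoint_absop Psym. Qed.

Lemma nm_absop x : nm (P x) = nm (T x).
Proof.
apply/eqP; rewrite -(eqrXn2 (isT : (0 < 2)%N)) ?nm_ge0// -!rdxx /rd.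
by rewrite dot_absop.
Qed.

Lemma paranormal_nm x : nm (adjoint T x) ^+ 2 <= nm (T (T x)) * nm x.
Proof. by have := Tpara x; rewrite !nmE -rmorphXn -rmorphM lecR. Qed.

Definition eigen (a : R) (x : H) := P x = a%:C *: x.

Definition reduces (a : R) := forall x, eigen a x -> eigen a (T x) /\ eigen a (adjoint T x).

(** For [a >= lam] this is the spectral subspace of |T| for the interval from 0 to [a], described
    through eigenvectors alone. *)
Definition lower (a : R) : closedSubspace H :=
  perp [set v | exists2 b, a < b & eigen b v].

Section Step.
Variable a : R.
Hypothesis lama : lam <= a.
Hypothesis above : forall b, a < b -> reduces b.

Local Notation M := (lower a).

Lemma lower_absop x : csub_set M x -> csub_set M (P x).
Proof.
move=> xM v [b ab vb]; rewrite Psym vb dotZr.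
by rewrite (xM v) ?mulr0//; exists b.
Qed.

Lemma lower_op x : csub_set M x -> csub_set M (T x).
Proof.
move=> xM v [b ab /(above ab)[_ vb]]; rewrite adjointP.
by apply: xM; exists b.
Qed.

Lemma lower_adjoint x : csub_set M x -> csub_set M (adjoint T x).
Proof.
move=> xM v [b ab /(above ab)[vb _]]; rewrite adjointPr.
by apply: xM; exists b.
Qed.

Lemma lower_le x : csub_set M x -> nm (T x) <= a * nm x.
Proof.
move=> xM; rewrite -nm_absop; apply: (max_eigen P0 lam0 PK lower_absop lama) => //.
move=> y b yM ab yb; apply: nm_eq0; apply/eqP; rewrite -sqrf_eq0 -rdxx.
by rewrite rd_eq0// yM//; exists b.
Qed.

Lemma eigen_lower x : eigen a x -> csub_set M x.
Proof.
move=> xa v [b ab vb]; apply: (eigen_orthogonal P0 _ xa vb).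
by rewrite lt_eqF.
Qed.

(* On [lower a] the norm of T is at most a; for x in the eigenspace the
   *-paranormality at T x forces T to attain this bound at T x. *)
Lemma eigen_step x : eigen a x -> eigen a (T x).
Proof.
move=> xa; have xM := eigen_lower xa.
have a0 : 0 <= a by exact: le_trans lam0 lama.
have Tx : nm (T x) = a * nm x by rewrite -nm_absop xa nmZr ger0_norm.
apply: (eigen_of_norming P0 lower_absop a0 _ (lower_op xM)) => [y yM|].
  by rewrite nm_absop lower_le.
(* Since $T^*Tx = a^2x$, this reads $a^4|x|^2 \leq |T^3x||Tx|$. With $|T^3x| \leq a|T^2x|$ and $|Tx|
   = a|x|$ it becomes $a|Tx| \leq |T^2x|$. *)
rewrite nm_absop; have := paranormal_nm (T x).
rewrite adjoint_absop xa bopZ xa !nmZr ger0_norm// => h.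
have h2 := lower_le (lower_op (lower_op xM)).
have [x0|x0] := eqVneq (a * nm x) 0.
  by rewrite Tx x0 mulr0 nm_ge0.
have ax : 0 < a * nm x.
  by rewrite lt_neqAle eq_sym x0 mulr_ge0// nm_ge0.
have a_gt0 : 0 < a.
  move: ax; rewrite pmulr_lgt0// nm_gt0//.
  by apply: contra_neq x0 => ->; rewrite nm0 mulr0.
move: h h2; rewrite Tx; move: (nm (T (T x))) (nm (T (T (T x)))) (nm x) ax => p q r ar h h2.
have h3 : (a * (a * r)) ^+ 2 <= a * p * (a * r).
  by apply: le_trans h _; rewrite ler_wpM2r// ltW.
have {}h3 : a * (a * r) * (a * (a * r)) <= p * (a * (a * r)).
  by move: h3; rewrite expr2; lra.
by rewrite -(ler_pM2r (mulr_gt0 a_gt0 ar)).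
Qed.

End Step.
End StarParanormal.

Section Reducing.
Context {R : realType} {H : hilbertType R}.
Variables (T : bop H H) (lam : R).
Hypothesis Tpara : star_paranormal T.
Hypothesis lam0 : 0 <= lam.
Hypothesis PK : compact_op (absop T - lam%:C *: idop H).

Let P0 : positive_op (absop T) := (absopP T).1.

Lemma eigenB a x y : eigen T a x -> eigen T a y -> eigen T a (x - y).
Proof. by rewrite /eigen => xa ya; rewrite bopB xa ya scalerBr. Qed.

Lemma eigenZ a c x : eigen T a x -> eigen T a (c *: x).
Proof. by rewrite /eigen => xa; rewrite bopZ xa !scalerA mulrC. Qed.

Lemma eigen_adjoint_op a x : eigen T a x -> adjoint T (T x) = (a ^+ 2)%:C *: x.
Proof.
by move=> xa; rewrite adjoint_absop xa bopZ xa scalerA -rmorphM -expr2.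
Qed.

Lemma eigen_dot a x y : eigen T a y -> dot (T x) (T y) = (a ^+ 2)%:C * dot x y.
Proof.
by move=> ya; rewrite adjointP (eigen_adjoint_op ya) dotZr conjc_real.
Qed.

(* If z is orthogonal to T(N), then the vectors a^-n T^n z are orthonormal,
   which is impossible since |T| - lam is compact. *)
Lemma eigen_onto a z : lam < a -> (forall x, eigen T a x -> eigen T a (T x)) ->
  eigen T a z -> exists2 x, eigen T a x & T x = z.
Proof.
move=> lama Ta za; have a0 : 0 < a by exact: le_lt_trans lama.
pose N := null_space (absop T - a%:C *: idop H).
have NP x : csub_set N x <-> eigen T a x by exact: null_spaceP.
have Wc (x : N) : a * nm x <= nm ((T \oB inclop N) x).
  rewrite -[nm x]/(nm (csub_val x)) -[(_ \oB _) x]/(T (csub_val x)).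
  have /NP xa := csub_in x.
  by rewrite -nm_absop xa nmZr gtr0_norm.
have [x xP] := least_squares z a0 Wc.
have xN : eigen T a (csub_val x) by exact/NP/csub_in.
exists (csub_val x) => //; set w := z - T (csub_val x) in xP.
have wP y : eigen T a y -> dot w (T y) = 0.
  by move=> /NP yN; exact: (xP (csub_of yN)).
have wa : eigen T a w by apply: eigenB => //; exact: Ta.
have [w0|w0] := eqVneq w 0; first by apply/eqP; rewrite eq_sym -subr_eq0 -/w w0.
exfalso.
pose g y := (a^-1)%:C *: T y.
have ga y : eigen T a y -> eigen T a (g y) by move=> /Ta; exact: eigenZ.
have gdot x' y : eigen T a y -> dot (g x') (g y) = dot x' y.
  move=> ya; rewrite /g dotZl dotZr conjc_real (eigen_dot _ ya) !mulrA -!rmorphM.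
  by rewrite -expr2 -exprMn mulVf ?gt_eqF// expr1n mul1r.
pose v n := iter n g ((nm w)^-1%:C *: w).
have va n : eigen T a (v n) by elim: n => [|n IH]; [exact: eigenZ|exact: ga].
have v1 n : nm (v n) = 1.
  elim: n => [|n IH]; first exact: nm_normalize.
  apply/eqP; rewrite -(eqrXn2 (isT : (0 < 2)%N)) ?nm_ge0// -!rdxx /rd.
  by rewrite gdot// dotxx IH.
have v0 n : dot (v 0%N) (v n.+1) = 0.
  by rewrite /v dotZl /= /g dotZr -/(g _) -/(v n) wP ?mulr0.
have vv m n : dot (v m) (v (m + n.+1)%N) = 0.
  by elim: m => [|m IH]; [exact: v0|rewrite addSn gdot].
have vneq m n : m != n -> dot (v m) (v n) = 0.
  have lt i j : (i < j)%N -> dot (v i) (v j) = 0.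
    by move=> ij; rewrite -(subnKC ij) addSnnS.
  by rewrite neq_ltn => /orP[/lt|/lt/dot_eq0C].
have al : 0 < a - lam by rewrite subr_gt0.
apply: infinite_nat; apply: (compact_finite (v := v) PK al) => [n _|m n _ _ mn].
  by rewrite v1.
have KE n' : (absop T - lam%:C *: idop H) (v n') = (a - lam)%:C *: v n'.
  by rewrite bopBE bopZE/= [absop T _]va rmorphB/= scalerBl.
rewrite !KE -scalerBr nmZr gtr0_norm// -[leLHS]mulr1 ler_wpM2l ?(ltW al)//.
rewrite -ler_sqr ?nnegrE ?nm_ge0// nmB_sqr (rd_eq0 (vneq _ _ mn)) !v1.
by rewrite mulr0 subr0 !expr1n lerDl.
Qed.

(** A number that is not an eigenvalue reduces trivially, so the failures above [a] are finite in
    number. At the largest one, [eigen_step] applies, and [eigen_onto] writes each eigenvector as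
    $Ty$, whose image under $T^*$ is $b^2y$. *)
Lemma reduces_all a : lam < a -> reduces T a.
Proof.
move=> lama; apply: contrapT => nra.
pose B := [set b : R | a <= b /\ ~ reduces T b].
have [||b [ab nb] bmax] := @finite_set_max _ B.
- have al : 0 < a - lam by rewrite subr_gt0.
  apply: sub_finite_set (eigen_finite P0 PK al) => b [ab nb] /=.
  split; first by rewrite addrC subrK.
  apply: contrapT => noeig; apply: nb => x xb.
  have [->|x0] := eqVneq x 0; last first.
    exfalso; apply: noeig; exists ((nm x)^-1%:C *: x); split; first exact: nm_normalize.
    exact: eigenZ.
  by rewrite !linear0; split; rewrite /eigen linear0 scaler0.
- by exists a; split.
apply: nb; have lamb : lam < b by exact: lt_le_trans lama ab.
have above c : b < c -> reduces T c.
  move=> bc; apply: contrapT => nc; have := bmax c.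
  by rewrite leNgt bc => /(_ _)/negP h; apply: h; split => //; exact: le_trans ab (ltW bc).
have Tb x : eigen T b x -> eigen T b (T x).
  exact: (eigen_step Tpara lam0 PK (ltW lamb) above).
move=> x xb; split; first exact: Tb.
have [y yb <-] := eigen_onto lamb Tb xb.
by rewrite (eigen_adjoint_op yb); exact: eigenZ.
Qed.

End Reducing.

(** * Compressions to closed subspaces and closed orthogonal sums *)

Section Subspaces.
Context {R : realType} {H : hilbertType R}.
Implicit Types M K : closedSubspace H.

Lemma compopE (E F G : hilbertType R) (S : bop F G) (Q : bop E F) x :
  (S \oB Q) x = S (Q x).
Proof. by []. Qed.

Lemma idopE (E : hilbertType R) (x : E) : idop E x = x.
Proof. by []. Qed.

Definition compress M (S : bop H H) : bop M M := projop M \oB S \oB inclop M.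

Lemma compressE M (S : bop H H) (x : M) :
  (forall y, csub_set M y -> csub_set M (S y)) ->
  csub_val (compress M S x) = S (csub_val x).
Proof. by move=> SM; apply: projop_id; exact/SM/csub_in. Qed.

Lemma compress_unitary M (S : bop H H) :
  (forall y, csub_set M y -> csub_set M (S y)) ->
  (forall x y, csub_set M x -> csub_set M y -> dot (S x) (S y) = dot x y) ->
  (forall y, csub_set M y -> exists2 x, csub_set M x & S x = y) ->
  unitary_op (compress M S).
Proof.
move=> SM Sdot Sonto; set W := compress M S.
have WE x : csub_val (W x) = S (csub_val x) by exact: compressE.
have WW x : adjoint W (W x) = x.
  apply: dot_ext => z; rewrite -adjointP.
  change (dot (csub_val (W z)) (csub_val (W x)) = dot (csub_val z) (csub_val x)).
  by rewrite !WE Sdot//; exact: csub_in.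
split; apply: bop_ext => y; first exact: WW.
have [x xM Sx] := Sonto _ (csub_in y).
suff <- : W (csub_of xM) = y by exact: (congr1 W (WW _)).
by apply: val_inj; rewrite [LHS]WE.
Qed.

Lemma adjoint_comp_eq0 M K (V : bop M M) (A : bop K M) :
  (forall x y, dot (csub_val (V x)) (csub_val (A y)) = 0) ->
  adjoint V \oB A = 0.
Proof.
move=> VA; apply: bop_ext => y; apply: dot_ext => x.
by rewrite -adjointP dot0r; exact: VA.
Qed.

Lemma adjoint_csub M (B : bop M M) (x : M) (y : H) : csub_set M y ->
  (forall z, dot (csub_val (B z)) (csub_val x) = dot (csub_val z) y) ->
  csub_val (adjoint B x) = y.
Proof.
move=> yM By; rewrite -[RHS]/(csub_val (csub_of yM)); congr csub_val.
by apply: dot_ext => z; rewrite -adjointP; exact: By.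
Qed.

Lemma projop_sub M K x : (forall y z, csub_set M y -> csub_set K z -> dot y z = 0) ->
  csub_set K (x - csub_val (projop M x)) ->
  csub_val (projop K x) = x - csub_val (projop M x).
Proof.
move=> MK xK; rewrite -[RHS]/(csub_val (csub_of xK)); congr csub_val.
apply: projf_unique => z zK /=; rewrite opprB addrC subrK.
by apply: MK => //; exact: csub_in.
Qed.

End Subspaces.

Section ClosedSum.
Context {R : realType} {H : hilbertType R}.
Variables (I : set nat) (N : nat -> closedSubspace H).

Lemma algebraic_sum_widen x m (c : nat -> H) m' : (m <= m')%N ->
  (forall i, I i -> csub_set (N i) (c i)) -> x = \sum_(i < m | `[< I i >]) c i ->
  exists2 c' : nat -> H, forall i, I i -> csub_set (N i) (c' i) &
    x = \sum_(i < m' | `[< I i >]) c' i.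
Proof.
move=> mm' cN ->; exists (fun i => if (i < m)%N then c i else 0).
  by move=> i Ii; case: ifP => _; [exact: cN|exact: csub_set0].
by rewrite (big_ord_widen_cond m' (fun i => `[< I i >]) c mm') -big_mkcondr.
Qed.

Lemma algebraic_sum_linear (a : R[i]) x y :
  algebraic_sum I N x -> algebraic_sum I N y -> algebraic_sum I N (a *: x + y).
Proof.
move=> [m [c [cN xE]]] [n [d [dN yE]]].
have [c' c'N ->] := algebraic_sum_widen (leq_maxl m n) cN xE.
have [d' d'N ->] := algebraic_sum_widen (leq_maxr m n) dN yE.
exists (maxn m n), (fun i => a *: c' i + d' i); split.
  by move=> i Ii; apply: csub_set_linear; [exact: c'N|exact: d'N].
by rewrite scaler_sumr -big_split.
Qed.

Lemma algebraic_sum_mem i x : I i -> csub_set (N i) x -> algebraic_sum I N x.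
Proof.
move=> Ii xN; exists i.+1, (fun j => if j == i then x else 0); split.
  by move=> j _; case: eqP => [->//|_]; exact: csub_set0.
rewrite (bigD1 ord_max)/=; last by apply/asboolP.
rewrite eqxx big1 ?addr0// => j /andP[_ /negPf ji].
rewrite -[X in X == i]/(nat_of_ord j) -[X in _ == X]/(nat_of_ord (@ord_max i)).
by rewrite (inj_eq val_inj) ji.
Qed.

Fact closed_sum0 : closure (algebraic_sum I N) 0.
Proof.
apply: subset_closure; exists 0%N, (fun=> 0); split; last by rewrite big_ord0.
by move=> i _; exact: csub_set0.
Qed.

Fact closed_sum_linear (a : R[i]) x y :
  closure (algebraic_sum I N) x -> closure (algebraic_sum I N) y ->
  closure (algebraic_sum I N) (a *: x + y).
Proof.
move=> /closureP xA /closureP yA; apply/closureP => e e0.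
have a0 : 0 <= complex.Re `|a| by rewrite normc_def sqrtr_ge0.
have a1 : 0 < 2 * (complex.Re `|a| + 1) by rewrite mulr_gt0// ltr_wpDl.
have e20 : 0 < e / 2 by rewrite divr_gt0.
have [x' x'A xx'] := xA _ (divr_gt0 e0 a1); have [y' y'A yy'] := yA _ e20.
exists (a *: x' + y'); first exact: algebraic_sum_linear.
rewrite opprD addrACA -scalerBr; apply: le_lt_trans (nmD _ _) _.
rewrite nmZ; move: xx' yy'; rewrite ltr_pdivlMr//.
move: (nm_ge0 (x - x')) a0; move: (nm _) (nm _) (complex.Re _) => q p r p0 r0 h1 h2.
suff : r * p + q < e by [].
by nra.
Qed.

Definition closed_sum : closedSubspace H :=
  ClosedSubspace closed_sum0 closed_sum_linear (@closed_closure _ _).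

Lemma closed_sum_mem i x : I i -> csub_set (N i) x -> csub_set closed_sum x.
Proof. by move=> Ii xN; apply: subset_closure; exact: algebraic_sum_mem xN. Qed.

Lemma closed_sum_perp y : (forall i, I i -> forall x, csub_set (N i) x -> dot y x = 0) ->
  forall x, csub_set closed_sum x -> dot y x = 0.
Proof.
move=> yN x xA; apply: dot_eq0C.
have {}xA : closure (algebraic_sum I N) x := xA.
suff : [set x | forall z, [set y] z -> dot x z = 0] x by apply.
apply: perp_set_closed; apply: closureS xA => _ [m [c [cN ->]]] _ ->; apply: dot_eq0C.
elim/big_ind: _ => [|u v u0 v0|i /asboolP Ii]; first exact: dot0r.
  by rewrite dotDr u0 v0 addr0.
exact: (yN _ Ii _ (cN _ Ii)).
Qed.

End ClosedSum.

Theorem theorem2p10 (R : realType) (H : hilbertType R) (T : bop H H) :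
  infinite_dimensional H ->
  closure (absolutely_norm_attaining H) T ->
  star_paranormal T ->
  exists (H0 H1 H2 : closedSubspace H)
         (V0 : bop H0 H0) (V : bop H1 H1) (A : bop H2 H1) (B : bop H2 H2)
         (lambda : R) (n : option nat) (alpha : nat -> R)
         (U : forall i, bop (null_space (absop T - (alpha i)%:C *: idop H))
                            (null_space (absop T - (alpha i)%:C *: idop H))),
  [/\ orthogonal_decomposition3 H0 H1 H2,
      block_matrix3 T V0 0              0
                    0  (lambda%:C *: V) A
                    0  0                B &
  [/\ essential_spectrum (absop T) = [set lambda%:C] /\ 0 <= lambda,
      [/\ set_inj (index_set n) alpha,
          alpha @` index_set n =
            [set a : R | [/\ lambda < a, a <= opnorm T
                           & spectrum (absop T) a%:C]],
          hilbert_sum (index_set n)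
            (fun i => null_space (absop T - (alpha i)%:C *: idop H)) H0,
          csub_set H1 = csub_set (null_space (absop T - lambda%:C *: idop H)) &
          csub_set H2 =
            orthogonal_complement (sum_set (csub_set H0) (csub_set H1))],
      (forall i, index_set n i -> unitary_op (U i)) /\
      hilbert_sum_op (index_set n) (fun i => (alpha i)%:C *: U i) V0 &
      [/\ (exists x : H1, x != 0) -> isometric_op V,
          adjoint V \oB A = 0,
          le_op (adjoint A \oB A + adjoint B \oB B)
                ((lambda ^+ 2)%:C *: idop H2) &
          forall k : R, 0 < k ->
            positive_op ((lambda ^+ 4 + k ^+ 2)%:C *: idop H2
                         - (2 * k)%:C *: (B \oB adjoint B))]]].
Proof.
move=> Hinf Tcl Tpara; have [lam lam0 PK] := absop_compact Hinf Tcl.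
have P0 := (absopP T).1.
have red := @reduces_all _ _ _ _ Tpara lam0 PK.
pose spec := [set a : R | [/\ lam < a, a <= opnorm T & spectrum (absop T) a%:C]].
have specP a x : lam < a -> eigen T a x -> x != 0 -> spec a.
  move=> lama xa x0; have a0 : 0 < a by exact: le_lt_trans lama.
  split=> //.
    rewrite -(ler_pM2r (nm_gt0 x0)); apply: le_trans (opnormP T x).
    by rewrite -nm_absop xa nmZr gtr0_norm.
  by apply: (eigen_spectrum (nm_normalize x0)); exact: eigenZ.
have [|e e0|n [alpha [ainj aE]]] := @enumeration R spec lam.
- by move=> a [].
- apply: sub_finite_set (eigen_finite P0 PK e0) => a [[lama _ sa] la] /=.
  by split=> //; apply: (spectrum_eigen P0 PK) sa; rewrite gt_eqF.
have alam i : index_set n i -> lam < alpha i.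
  by move=> ni; have [] : spec (alpha i) by rewrite -aE; exists i.
pose N i := null_space (absop T - (alpha i)%:C *: idop H).
have NP i x : csub_set (N i) x <-> eigen T (alpha i) x by exact: null_spaceP.
pose H0 := closed_sum (index_set n) N.
pose H1 := null_space (absop T - lam%:C *: idop H).
have H1P x : csub_set H1 x <-> eigen T lam x by exact: null_spaceP.
pose H2 := perp (sum_set (csub_set H0) (csub_set H1)).
have H0eig b v : lam < b -> eigen T b v -> csub_set H0 v.
  move=> lamb vb; have [->|v0] := eqVneq v 0; first exact: csub_set0.
  have : spec b by exact: specP vb v0.
  by rewrite -aE => -[i ni ib]; apply: (closed_sum_mem ni); apply/NP; rewrite ib.
(* With [H0perp]: the orthogonal complement of [H0] is exactly [lower T lam], so what is known about
   [lower] applies to [H1] and [H2]. *)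
have perpH0 x : csub_set (lower T lam) x -> forall y, csub_set H0 y -> dot x y = 0.
  move=> xl; apply: closed_sum_perp => i ni y /NP yi; apply: xl.
  by exists (alpha i) => //; exact: alam.
have H0perp x : (forall y, csub_set H0 y -> dot x y = 0) -> csub_set (lower T lam) x.
  by move=> xH0 v [b lamb vb]; apply: xH0; exact: H0eig vb.
have H01 x y : csub_set H0 x -> csub_set H1 y -> dot x y = 0.
  move=> xH0 /H1P yl; apply: dot_eq0C; apply: perpH0 xH0; exact: eigen_lower.
have H02 x y : csub_set H0 x -> csub_set H2 y -> dot x y = 0.
  move=> xH0 yH2; apply: dot_eq0C; apply: yH2; exists x => //; exists 0; last by rewrite addr0.
  exact: csub_set0.
have H12 x y : csub_set H1 x -> csub_set H2 y -> dot x y = 0.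
  move=> xH1 yH2; apply: dot_eq0C; apply: yH2; exists 0; first exact: csub_set0.
  by exists x => //; rewrite add0r.
have H2in x : (forall y, csub_set H0 y -> dot x y = 0) ->
    (forall y, csub_set H1 y -> dot x y = 0) -> csub_set H2 x.
  by move=> x0 x1 _ [y yH0] [z zH1 <-]; rewrite dotDr x0// x1// addr0.
have H2low x : csub_set H2 x -> csub_set (lower T lam) x.
  by move=> xH2; apply: H0perp => y yH0; apply: dot_eq0C; exact: H02.
(* Invariance passes to the adjoint on the complement: $T^*$ preserves [lower T lam], hence $T$
   preserves its complement [H0]. *)
have TH0 x : csub_set H0 x -> csub_set H0 (T x).
  move=> xH0; apply: perp_perp => w wH0; rewrite adjointP; apply: dot_eq0C.
  apply: perpH0 xH0; exact: (lower_adjoint red (H0perp _ wH0)).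
have TH1 x : csub_set H1 x -> csub_set H1 (T x).
  by move=> /H1P xl; apply/H1P; exact: (eigen_step Tpara lam0 PK (lexx lam) red xl).
have nmH1 x : csub_set H1 x -> nm (T x) = lam * nm x.
  by move=> /H1P xl; rewrite -nm_absop xl nmZr ger0_norm.
have nmlow x : csub_set (lower T lam) x -> nm (T x) <= lam * nm x.
  by move=> xl; exact: (lower_le lam0 PK (lexx lam) xl).
have TH2 x : csub_set H2 x -> csub_set (lower T lam) (T x).
  by move=> /H2low xl; exact: (lower_op red xl).
(* For $\lambda = 0$ the operator |T| vanishes on the complement of [H0], so that [H2] lies in [H1]
   and is orthogonal to it. *)
have lamV x : lam = 0 -> csub_set H2 x -> x = 0.
  move=> l0 xH2; have := nmlow _ (H2low _ xH2); rewrite l0 mul0r => Tx.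
  have Px : absop T x = 0.
    by apply: nm_eq0; apply/eqP; rewrite nm_absop eq_le Tx nm_ge0.
  have xH1 : csub_set H1 x by apply/H1P; rewrite /eigen Px l0 scale0r.
  by apply: nm_eq0; apply/eqP; rewrite -sqrf_eq0 -rdxx rd_eq0// H12.
pose V0 := compress H0 T.
pose W := compress H1 T.
(* For $\lambda = 0$ any [V] fits the block $\lambda V = 0$; the identity is an isometry. *)
pose V : bop H1 H1 := if lam == 0 then idop H1 else (lam^-1)%:C *: W.
pose A : bop H2 H1 := projop H1 \oB T \oB inclop H2.
pose B := compress H2 T.
(* Outside [index_set n] the number [alpha i] is arbitrary and [U i] a mere placeholder. *)
pose U i := compress (N i) (((alpha i)^-1)%:C *: T).
have V0E (x : H0) : csub_val (V0 x) = T (csub_val x).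
  exact: compressE.
have WE (x : H1) : csub_val (W x) = T (csub_val x).
  exact: compressE.
have VE (x : H1) : lam%:C *: csub_val (V x) = T (csub_val x).
  rewrite /V; have [l0|l0] := eqVneq lam 0.
    rewrite l0 scale0r; apply/esym/nm_eq0.
    by rewrite (nmH1 _ (csub_in x)) l0 mul0r.
  by rewrite bopZE csub_valZ scalerA -rmorphM divff// scale1r WE.
(* $Tx$ stays in the complement of [H0], so its components in [H1] and [H2] exhaust it. *)
have ABE (x : H2) : T (csub_val x) = csub_val (A x) + csub_val (B x).
  set y := T _; have yl : csub_set (lower T lam) y by exact/TH2/csub_in.
  have y2 : csub_set H2 (y - csub_val (projop H1 y)).
    apply: H2in => z zH; last exact: projopP.
    by rewrite dotBl (perpH0 _ yl)// (dot_eq0C (H01 _ _ zH (csub_in _))) subr0.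
  have -> : csub_val (B x) = y - csub_val (projop H1 y) by exact: projop_sub.
  by rewrite addrC subrK.
have alpha0 i : index_set n i -> alpha i != 0.
  by move=> ni; rewrite gt_eqF// (le_lt_trans lam0)// alam.
have TN i x : index_set n i -> csub_set (N i) x -> csub_set (N i) (T x).
  by move=> ni /NP xi; apply/NP; have [] := red _ (alam _ ni) _ xi.
have SN i x : index_set n i -> csub_set (N i) x ->
    csub_set (N i) ((((alpha i)^-1)%:C *: T) x).
  by move=> ni xi; rewrite bopZE; apply/csubZ/TN.
have UE i (x : N i) : index_set n i -> (alpha i)%:C *: csub_val (U i x) = T (csub_val x).
  move=> ni; rewrite compressE; last by move=> y; exact: SN.
  by rewrite bopZE scalerA -rmorphM divff ?alpha0// scale1r.
have Hsum : hilbert_sum (index_set n) N H0.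
  split=> // i j ni nj ij x y.
  have /NP xi := csub_in x; have /NP yj := csub_in y.
  by apply: (eigen_orthogonal P0 _ xi yj); apply/eqP => /ainj; rewrite !inE => /(_ ni nj).
(* $T^*x$ remains in [H2]: [lower T lam] is invariant under $T^*$, and $T$ maps [H1] into itself. As
   [A z] is orthogonal to [x], pairing with $Bz$ or $Tz$ is the same. *)
have adjB (x : H2) : csub_val (adjoint B x) = adjoint T (csub_val x).
  set y := adjoint T _; have yl : csub_set (lower T lam) y.
    exact: (lower_adjoint red (H2low _ (csub_in x))).
  have yH2 : csub_set H2 y.
    apply: H2in => z zH; first exact: perpH0.
    rewrite adjointPr; apply: dot_eq0C; apply: H12; last exact: csub_in.
    exact: TH1.
  apply: adjoint_csub => // z; rewrite -adjointP ABE dotDl.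
  by rewrite [dot (csub_val (A z)) _]H12 ?add0r//; exact: csub_in.
clearbody A B.
exists H0, H1, H2, V0, V, A, B, lam, n, alpha, U; split.
- split=> [x y|x y|x y|x].
  + by apply: H01; exact: csub_in.
  + by apply: H02; exact: csub_in.
  + by apply: H12; exact: csub_in.
  have x2 : csub_set H2 (x - csub_val (projop H0 x) - csub_val (projop H1 x)).
    apply: H2in => y yH.
      by rewrite dotBl projopP// (dot_eq0C (H01 _ _ yH (csub_in _))) subr0.
    rewrite addrAC dotBl projopP// H01 ?subr0//; exact: csub_in.
  exists (projop H0 x), (projop H1 x), (csub_of x2).
  by rewrite /= -(addrA x) -opprD [RHS]addrC subrK.
- move=> x0 x1 x2; rewrite !bop0E !add0r !addr0 bopZE csub_valD csub_valZ VE V0E.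
  by rewrite !bopD ABE !addrA.
split.
- by split=> //; exact: essential_spectrum_scalar.
- by split.
- split=> [i ni|]; last first.
    split=> // i ni x y yx; rewrite V0E bopZE csub_valZ UE//.
    by rewrite yx.
  have lama := alam _ ni; have ai := alpha0 _ ni.
  apply: compress_unitary => [y|x y _ /NP yi|y /NP yi]; first exact: SN.
    rewrite !bopZE dotZl dotZr conjc_real (eigen_dot _ yi) !mulrA -!rmorphM.
    by rewrite -expr2 -exprMn mulVf// expr1n mul1r.
  have [x xi <-] := eigen_onto lam0 PK lama (fun x xi => (red _ lama x xi).1) yi.
  exists ((alpha i)%:C *: x); first by apply/NP; exact: eigenZ.
  by rewrite bopZE bopZ scalerA -rmorphM mulVf// scale1r.
- split.
  + move=> _ x; rewrite !nmE; congr (_%:C); rewrite !csub_nmE.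
    rewrite /V; have [l0|l0] := eqVneq lam 0; first by [].
    have lgt : 0 < lam by rewrite lt_neqAle eq_sym l0.
    rewrite bopZE csub_valZ nmZr WE nmH1; last exact: csub_in.
    by rewrite gtr0_norm ?invr_gt0// mulKf.
  + apply: adjoint_comp_eq0 => x y.
    have [l0|l0] := eqVneq lam 0.
      have y0 : y = 0 by apply: val_inj; apply: lamV => //; exact: csub_in.
      by rewrite y0 linear0 dot0r.
    have lC : lam%:C != 0 by rewrite -(rmorph0 (real_complex R)) (inj_eq (@complexI R)).
    (* $\lambda\langle Vx, Ay\rangle = \langle Tx, Ty\rangle = \lambda^2\langle x, y\rangle = 0$;
       replacing [A y] by [T y] only adds [B y], which is orthogonal to [H1]. *)
    apply: (mulfI lC); rewrite mulr0 -dotZl VE.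
    have -> : dot (T (csub_val x)) (csub_val (A y)) = dot (T (csub_val x)) (T (csub_val y)).
      rewrite ABE dotDr [X in _ + X]H12 ?addr0//; first exact/TH1/csub_in.
      exact: csub_in.
    rewrite dot_eq0C// (eigen_dot (a := lam))//.
      by rewrite dot_eq0C ?mulr0// H12//; exact: csub_in.
    by apply/H1P; exact: csub_in.
  + apply: positive_rd => [x y|x].
      rewrite !bopBE !bopZE !bopDE !compopE !idopE !rdBl !rdBr !rdZl !rdZr !rdDl !rdDr.
      by congr (_ - _); rewrite !rd_adjointl -!rd_adjoint.
    rewrite !bopBE !bopZE !bopDE !compopE !idopE !rdBl !rdZl !rdDl.
    have Tx := nmlow _ (H2low _ (csub_in x)).
    rewrite !rd_adjointl !rdxx subr_ge0.
    have <- : nm (T (csub_val x)) ^+ 2 = nm (A x) ^+ 2 + nm (B x) ^+ 2.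
      rewrite ABE nmD_sqr rd_eq0 ?mulr0 ?addr0//; apply: H12; exact: csub_in.
    by rewrite -exprMn ler_sqr ?nnegrE ?mulr_ge0 ?nm_ge0.
  + move=> k k0; apply: positive_rd => [x y|x].
      rewrite !bopBE !bopZE !compopE !idopE !rdBl !rdBr !rdZl !rdZr; congr (_ - _ * _).
      by rewrite rd_adjoint rd_adjointl.
    rewrite !bopBE !bopZE !compopE !idopE !rdBl !rdZl rdxx rd_adjoint rdxx.
    have h1 := paranormal_nm Tpara (csub_val x).
    rewrite -adjB -!csub_nmE in h1.
    have h2 := nmlow _ (TH2 _ (csub_in x)).
    have h3 := nmlow _ (H2low _ (csub_in x)).
    rewrite -!csub_nmE in h3; have := nm_ge0 x.
    move: h1 h2 h3; move: (nm (adjoint B x)) (nm x) (nm (T (csub_val x))).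
    move: (nm (T (T (csub_val x)))) => p b r q h1 h2 h3 r0.
    have hb : b ^+ 2 <= lam ^+ 2 * r ^+ 2.
      apply: le_trans h1 _; rewrite [r ^+ 2]expr2 mulrA ler_wpM2r//.
      by apply: le_trans h2 _; rewrite expr2 -mulrA ler_wpM2l.
    (* By [hb] the form is at least $(\lambda^4 + k^2 - 2k\lambda^2)r^2 = (\lambda^2 - k)^2r^2$. *)
    have i1 := mulr_ge0 (sqr_ge0 (lam ^+ 2 - k)) (sqr_ge0 r).
    have i2 := ler_wpM2l (ltW k0) hb.
    suff : 0 <= (lam ^+ 4 + k ^+ 2) * r ^+ 2 - 2 * k * b ^+ 2 by [].
    by nra.
Qed.
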